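(* Let $m\in\mathbb{R}$, $0<\rho\le 1$ and $0\le\delta\le 1$. A function $\widetilde a:\mathbb{T}^n\times\mathbb{Z}^n\to\mathbb{C}$ is a toroidal symbol $\widetilde a\in S^m_{\rho,\delta}(\mathbb{T}^n\times\mathbb{Z}^n)$ if and only if there exists a Euclidean symbol $a\in S^m_{\rho,\delta}(\mathbb{T}^n\times\mathbb{R}^n)$ such that $\widetilde a=a|_{\mathbb{T}^n\times\mathbb{Z}^n}$. Moreover, this extended symbol $a$ is unique modulo $S^{-\infty}(\mathbb{T}^n\times\mathbb{R}^n)$: if $a,b\in S^m_{\rho,\delta}(\mathbb{T}^n\times\mathbb{R}^n)$ satisfy $a|_{\mathbb{T}^n\times\mathbb{Z}^n}=b|_{\mathbb{T}^n\times\mathbb{Z}^n}$, then $a-b\in S^{-\infty}(\mathbb{T}^n\times\mathbb{R}^n)$.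
   Context: $\mathbb{T}^n=(\mathbb{R}/2\pi\mathbb{Z})^n$; functions on $\mathbb{T}^n$ are identified with functions on $\mathbb{R}^n$ that are $2\pi$-periodic in each coordinate. $\langle\xi\rangle=(1+|\xi|^2)^{1/2}$. For $\sigma:\mathbb{Z}^n\to\mathbb{C}$ put $\triangle_{\xi_j}\sigma(\xi)=\sigma(\xi+e_j)-\sigma(\xi)$ ($e_j$ the $j$-th standard unit vector) and $\triangle_\xi^\alpha=\triangle_{\xi_1}^{\alpha_1}\cdots\triangle_{\xi_n}^{\alpha_n}$ for $\alpha\in\mathbb{N}_0^n$. $S^m_{\rho,\delta}(\mathbb{T}^n\times\mathbb{Z}^n)$ is the set of functions $a(x,\xi)$ on $\mathbb{T}^n\times\mathbb{Z}^n$, smooth in $x$ for every $\xi\in\mathbb{Z}^n$, such that for all $\alpha,\beta\in\mathbb{N}_0^n$ there is a constant $C_{\alpha\beta}$ with $|\triangle_\xi^\alpha\partial_x^\beta a(x,\xi)|\le C_{\alpha\beta}\langle\xi\rangle^{m-\rho|\alpha|+\delta|\beta|}$ for all $x\in\mathbb{T}^n$, $\xi\in\mathbb{Z}^n$. $S^m_{\rho,\delta}(\mathbb{T}^n\times\mathbb{R}^n)$ is the set of $b\in C^\infty(\mathbb{R}^n\times\mathbb{R}^n)$ with $b(\cdot,\xi)$ $2\pi$-periodic for every $\xi$, such that for all $\alpha,\beta\in\mathbb{N}_0^n$ there is $C_{\alpha\beta}$ with $|\partial_\xi^\alpha\partial_x^\beta b(x,\xi)|\le C_{\alpha\beta}\langle\xi\rangle^{m-\rho|\alpha|+\delta|\beta|}$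 for all $x,\xi\in\mathbb{R}^n$. $S^{-\infty}(\mathbb{T}^n\times\mathbb{R}^n)$ is the set of such smooth $2\pi$-periodic (in $x$) functions all of whose derivatives $\partial_\xi^\alpha\partial_x^\beta b(x,\xi)$ are $O(\langle\xi\rangle^{-N})$ uniformly in $x$ for every $N$. *)

(* Defs.v *)
From HB Require Import structures.
From mathcomp Require Import all_boot all_order all_algebra complex.
From mathcomp Require Import all_classical all_reals all_analysis.
Set Implicit Arguments.
Unset Strict Implicit.
Unset Printing Implicit Defensive.
Import Order.TTheory GRing.Theory Num.Theory.
Import numFieldNormedType.Exports.
Local Open Scope classical_set_scope.
Local Open Scope ring_scope.
Local Open Scope complex_scope.

(** ** Multi-indices *)

Definition mabs (n : nat) (alpha : 'I_n -> nat) : nat :=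
  (\sum_(i < n) alpha i)%N.

(* The multi-index power D_0^(alpha 0) \o ... \o D_(n-1)^(alpha (n-1)). *)
Definition mpow (T : Type) (n : nat) (D : 'I_n -> T -> T)
    (alpha : 'I_n -> nat) : T -> T :=
  \big[@comp T T T/@id T]_(i < n) iter (alpha i) (D i).

(** ** Complex-valued functions of real variables *)

(* R[i] is not a normed module over R in the library, so that continuity,
   differentiability and derivatives along real directions of complex-valued
   functions are taken on the real and imaginary parts. *)

Section ComplexValued.
Variables (R : realType) (V : normedModType R).
Implicit Types (f : V -> R[i]) (v z : V).

Definition ccontinuous f : Prop :=
  continuous (fun z => complex.Re (f z)) /\
  continuous (fun z => complex.Im (f z)).

Definition cderivable f z v : Prop :=
  derivable (fun y => complex.Re (f y)) z v /\
  derivable (fun y => complex.Im (f y)) z v.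

Definition cderive v f : V -> R[i] := fun z =>
  'D_v (fun y => complex.Re (f y)) z +i* 'D_v (fun y => complex.Im (f y)) z.

(* C^oo with respect to the coordinates given by a basis e of V: every
   iterated partial derivative, along any finite sequence of coordinates,
   exists everywhere and is continuous. *)
Definition csmooth (I : Type) (e : I -> V) f : Prop :=
  forall s : seq I,
    let g := foldr (fun i => cderive (e i)) f s in
    ccontinuous g /\ (forall (i : I) z, cderivable g z (e i)).

End ComplexValued.

Section Symbols.
Variables (R : realType) (n : nat).

Definition unitv (j : 'I_n) : 'rV[R]_n := delta_mx 0 j.

Definition periodic2pi (f : 'rV[R]_n -> R[i]) : Prop :=
  forall (x : 'rV[R]_n) (j : 'I_n), f (x + (2 * pi) *: unitv j) = f x.

(* (1 + |xi|^2)^(1/2) for the Euclidean norm; the library norm of 'rV[R]_n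
   is the sup norm. *)
Definition japanese (xi : 'rV[R]_n) : R :=
  Num.sqrt (1 + \sum_(i < n) xi 0 i ^+ 2).

Definition latt (k : 'rV[int]_n) : 'rV[R]_n := map_mx intr k.

Definition fdiff (j : 'I_n) (sigma : 'rV[int]_n -> R[i]) :
    'rV[int]_n -> R[i] :=
  fun k => sigma (k + delta_mx 0 j) - sigma k.

Definition toroidal_symbol (m rho delta : R)
    (a : 'rV[R]_n -> 'rV[int]_n -> R[i]) : Prop :=
  [/\ forall k, periodic2pi (a^~ k),
      forall k, csmooth unitv (a^~ k) &
      forall alpha beta : 'I_n -> nat, exists C : R,
        forall (x : 'rV[R]_n) (k : 'rV[int]_n),
          `| mpow fdiff alpha
               (fun l => mpow (fun j => cderive (unitv j)) beta (a^~ l) x) k |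
          <= (C * japanese (latt k) `^
                    (m - rho * (mabs alpha)%:R + delta * (mabs beta)%:R))%:C].

(* Coordinate directions of R^n x R^n: inl j is the x_j direction and inr j
   is the xi_j direction. *)
Definition unitxxi (i : 'I_n + 'I_n) : 'rV[R]_n * 'rV[R]_n :=
  match i with inl j => (unitv j, 0) | inr j => (0, unitv j) end.

Definition dxxi (alpha beta : 'I_n -> nat)
    (b : 'rV[R]_n * 'rV[R]_n -> R[i]) : 'rV[R]_n * 'rV[R]_n -> R[i] :=
  mpow (fun j => cderive (unitxxi (inr j))) alpha
    (mpow (fun j => cderive (unitxxi (inl j))) beta b).

Definition euclidean_symbol (m rho delta : R)
    (b : 'rV[R]_n * 'rV[R]_n -> R[i]) : Prop :=
  [/\ csmooth unitxxi b,
      forall xi, periodic2pi (fun x => b (x, xi)) &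
      forall alpha beta : 'I_n -> nat, exists C : R,
        forall x xi : 'rV[R]_n,
          `| dxxi alpha beta b (x, xi) |
          <= (C * japanese xi `^
                    (m - rho * (mabs alpha)%:R + delta * (mabs beta)%:R))%:C].

Definition smoothing_symbol (b : 'rV[R]_n * 'rV[R]_n -> R[i]) : Prop :=
  [/\ csmooth unitxxi b,
      forall xi, periodic2pi (fun x => b (x, xi)) &
      forall (alpha beta : 'I_n -> nat) (N : nat), exists C : R,
        forall x xi : 'rV[R]_n,
          `| dxxi alpha beta b (x, xi) |
          <= (C * japanese xi `^ (- N%:R))%:C].

End Symbols.

(* Main.v *)
Require Import Defs.
From mathcomp Require Import all_boot all_order all_algebra complex.
From mathcomp Require Import all_classical all_reals all_analysis.
From mathcomp Require Import ring lra.
Import Order.TTheory GRing.Theory Num.Theory.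
Import numFieldNormedType.Exports.
Set Implicit Arguments.
Unset Strict Implicit.
Unset Printing Implicit Defensive.
Local Open Scope classical_set_scope.
Local Open Scope ring_scope.
Local Open Scope complex_scope.

(** A toroidal symbol [u] is extended by gluing its Newton interpolation
    polynomials with a smooth partition of unity on the lattice:
    [a(x, xi) = sum_k sum_p (Delta^p u)(x, k) prod_j w_(p j)(xi_j - k_j)], where
    [w_p(t) = cutoff(t) binom(t, p)] and [p] ranges over multi-indices with
    entries at most [order k].  By Pascal's rule the Newton polynomials of
    neighbouring lattice points, truncated at the same degree [Q], differ by a
    single term containing a difference of order [Q + 1], so that a [xi]-derivative
    of order [|alpha|] is controlled by differences of order at least [|alpha|].
    As in Borel's lemma, [order k] tends to infinity so slowly that the constants
    of the terms of higher order are absorbed by one power [<k>^rho].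

    Conversely, differences of a Euclidean symbol are values of its derivatives at
    nearby points.  A Euclidean symbol vanishing on the lattice is rapidly
    decreasing: going through the coordinates one at a time, smallness at the
    integers and of a high derivative (this is where [rho > 0] is used) forces
    all intermediate derivatives to be small. *)

(** * Cutoff function and Newton polynomials in one variable *)

Section Smooth1.
Variable R : realType.
Implicit Types (f g : R -> R).

(** Recursion through the first derivative lets closure under products, inverses and composition
    follow by induction on [k] from the rule for one derivative. *)
Fixpoint Cn (k : nat) f : Prop :=
  if k is k'.+1 then (forall t, derivable f t 1) /\ Cn k' (derive1 f) else True.

Definition smooth1 f : Prop := forall i t, derivable (derive1n i f) t 1.

Lemma smooth1P f : smooth1 f <-> forall k, Cn k f.
Proof.
split => [sf k|cf i].
  elim: k f sf => //= k IH f sf; split; first exact: (sf 0%N).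
  by apply: IH => i t; rewrite -derive1Sn; exact: sf.
elim: i f cf => [|i IH] f cf t; first by have [+ _] := cf 1%N; exact.
rewrite derive1Sn; apply: IH => k; by have [_] := cf k.+1.
Qed.

Lemma CnW k f : Cn k.+1 f -> Cn k f.
Proof. by elim: k f => //= k IH f [df Cf]; split=> //; exact: IH. Qed.

Lemma derive1_ext f (f' : R -> R) : 
  (forall t : R, is_derive t 1 f (f' t)) -> derive1 f = f'.
Proof. by move=> H; apply/funext => t; rewrite derive1E; exact: derive_val. Qed.

Lemma derivable_is_derive1 f t : derivable f t 1 -> is_derive t 1 f ((derive1 f) t).
Proof. by move=> df; rewrite derive1E; exact: DeriveDef. Qed.

Lemma CnD k f g : Cn k f -> Cn k g -> Cn k (f \+ g).
Proof.
elim: k f g => //= k IH f g [df Cf] [dg Cg]; split=> [t|]; first exact: derivableD.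
rewrite (_ : derive1 (f \+ g) = (derive1 f) \+ (derive1 g)); first exact: IH.
by apply/derive1_ext => t; apply: is_deriveD; exact: derivable_is_derive1.
Qed.

Lemma CnM k f g : Cn k f -> Cn k g -> Cn k (f \* g).
Proof.
elim: k f g => //= k IH f g /[dup] [[df Cf] /CnW Wf] /[dup] [[dg Cg] /CnW Wg].
split=> [t|]; first exact: derivableM.
rewrite (_ : derive1 (f \* g) = (f \* (derive1 g)) \+ (g \* (derive1 f))).
  by apply: CnD; apply: IH.
by apply/derive1_ext => t; apply: is_deriveM; exact: derivable_is_derive1.
Qed.

Lemma CnN k f : Cn k f -> Cn k (\- f).
Proof.
elim: k f => //= k IH f [df Cf]; split=> [t|]; first exact: derivableN.
rewrite (_ : derive1 (\- f) = \- (derive1 f)); first exact: IH.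
by apply/derive1_ext => t; apply: is_deriveN; exact: derivable_is_derive1.
Qed.

Lemma CnV k f : (forall t, f t != 0) -> Cn k f -> Cn k (fun t => (f t)^-1).
Proof.
move=> f0; elim: k f f0 => //= k IH f f0 /[dup] [[df Cf] /CnW Wf].
split=> [t|]; first by apply: derivableV.
rewrite (_ : derive1 _ =
   (\- ((fun t => (f t)^-1) \* (fun t => (f t)^-1))) \* (derive1 f)).
  by apply: CnM => //; apply: CnN; apply: CnM; exact: IH.
apply/derive1_ext => t /=; apply: is_derive_eq.
  exact: (is_deriveV (f0 t) (derivable_is_derive1 _)).
by rewrite /GRing.scale /= -exprVn expr2.
Qed.

Lemma Cn_cst k (c : R) : Cn k (fun=> c).
Proof.
elim: k c => //= k IH c; split=> [t|]; first exact: derivable_cst.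
rewrite (_ : derive1 _ = fun=> 0 : R); first exact: IH.
by apply/derive1_ext => t; exact: is_derive_cst.
Qed.

Lemma Cn_id k : Cn k (@id R).
Proof.
case: k => //= k; split=> [t|]; first exact: derivable_id.
rewrite (_ : derive1 id = fun=> 1 : R); first exact: Cn_cst.
by apply/derive1_ext => t; exact: is_derive_id.
Qed.

Lemma Cn_comp k f g : Cn k f -> Cn k g -> Cn k (f \o g).
Proof.
elim: k f g => //= k IH f g [df Cf] /[dup] [[dg Cg] /CnW Wg]; split=> [t|].
  by apply/derivable1_diffP; apply: differentiable_comp; exact/derivable1_diffP.
rewrite (_ : derive1 (f \o g) = (derive1 f \o g) \* derive1 g).
  by apply: CnM => //; exact: IH.
by apply/funext => t; rewrite derive1_comp.
Qed.

Lemma derive1n_shift k f b :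
  derive1n k (fun s => f (s + b)) = fun s => derive1n k f (s + b).
Proof.
elim: k => // k IH; rewrite !derive1nS IH; apply/funext => t.
rewrite /derive1.
suff -> : (fun h => h^-1 *: (derive1n k f (h + t + b) - derive1n k f (t + b))) =
  (fun h => h^-1 *: (derive1n k f (h + (t + b)) - derive1n k f (t + b))) by [].
by apply/funext => h; rewrite addrA.
Qed.

Lemma near_derive1n k f g (t : R) :
  {near t, f =1 g} -> {near t, derive1n k f =1 derive1n k g}.
Proof.
move=> fg; elim: k => // k IH.
have /= := near_join IH; apply: filterS => s sfg.
by rewrite !derive1E; exact: near_eq_derive.
Qed.

Lemma derive1n_cst0 k : derive1n k (fun=> 0 : R) = fun=> 0 : R.
Proof.
by elim: k => // k IH; rewrite derive1nS IH; apply/funext => t; rewrite derive1_cst.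
Qed.

Lemma smooth1_continuous k f : smooth1 f -> continuous (derive1n k f).
Proof.
by move=> sf t; apply: differentiable_continuous; apply/derivable1_diffP; exact: sf.
Qed.

Lemma derive1nD k f g : smooth1 f -> smooth1 g ->
  derive1n k (f \+ g) = derive1n k f \+ derive1n k g.
Proof.
move=> sf sg; elim: k => // k IH; rewrite !derive1nS IH; apply: derive1_ext => t.
by apply: is_deriveD; apply: derivable_is_derive1; [exact: sf|exact: sg].
Qed.

Lemma smooth1D f g : smooth1 f -> smooth1 g -> smooth1 (f \+ g).
Proof. by rewrite !smooth1P => ? ? ?; exact: CnD. Qed.

Lemma smooth1M f g : smooth1 f -> smooth1 g -> smooth1 (f \* g).
Proof. by rewrite !smooth1P => ? ? ?; exact: CnM. Qed.

Lemma smooth1_shift f b : smooth1 f -> smooth1 (fun s => f (s + b)).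
Proof.
rewrite !smooth1P => sf k; apply: (@Cn_comp k f (fun s => s + b)) => //.
by apply: CnD; [exact: Cn_id|exact: Cn_cst].
Qed.

Lemma smooth1_poly (p : {poly R}) :
  smooth1 (fun t => p.[t]) /\ forall k, derive1n k (fun t => p.[t]) = (fun t => p^`(k).[t]).
Proof.
have D : forall q : {poly R}, derive1 (fun t => q.[t]) = (fun t => q^`().[t]).
  by move=> q; apply: derive1_ext => t; exact: is_derive_poly.
have E k : derive1n k (fun t => p.[t]) = (fun t => p^`(k).[t]).
  by elim: k => // k IH; rewrite derive1nS IH D derivnS.
split=> // i t; rewrite E; exact: derivable_horner.
Qed.

(** The bound forces [f 0 = 0] and keeps the difference quotient at [0] below [C * |h|]; this
    handles the origin for the flat functions below. *)
Lemma is_derive_quadratic f (C : R) :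
  (forall h, `|h| <= 1 -> `|f h| <= C * h ^+ 2) -> is_derive (0 : R) 1 f 0.
Proof.
move=> fC.
have f0 : f 0 = 0.
  by apply/eqP; rewrite -normr_le0 (le_trans (fC 0 _)) ?normr0// expr0n mulr0.
have C0 : 0 <= C.
  by have := fC 1; rewrite normr1 expr1n mulr1 => /(_ (lexx _)); exact: le_trans.
have cv : h^-1 *: (f (h *: 1 + 0) - f 0) @[h --> 0^'] --> (0 : R).
  apply/cvgrPdist_le => e e0; near=> h.
  have hn0 : h != 0 by near: h; exact: nbhs_dnbhs_neq.
  have h1 : `|h| <= 1 by near: h; apply: dnbhs0_le.
  have he : `|h| <= e / (C + 1) by near: h; apply: dnbhs0_le; rewrite divr_gt0// ltr_wpDl.
  rewrite addr0 f0 subr0 sub0r normrN /GRing.scale/= mulr1 normrM normfV.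
  rewrite ler_pdivrMl ?normr_gt0//; apply: le_trans (fC _ h1) _.
  rewrite -real_normK ?num_real// expr2 mulrCA; apply: ler_wpM2l => //.
  rewrite ler_pdivlMr ?ltr_wpDl// in he.
  by apply: le_trans he; rewrite mulrC ler_wpM2l// lerDl.
by apply: DeriveDef; [apply/cvg_ex; exists 0|exact: cvg_lim].
Unshelve. all: by end_near. Qed.

(** The classical flat function [exp(-1/t)] with a polynomial factor in [1/t], which makes the
    family closed under differentiation. *)
Definition flat (p : {poly R}) (t : R) : R :=
  if 0 < t then p.[t^-1] * expR (- t^-1) else 0.

(* Exponential decay absorbs the powers of [t^-1] that differentiation
   produces. *)
Lemma poly_expR_bound (p : {poly R}) :
  exists C : R, forall y : R, 1 <= y -> `|p.[y] * expR (- y)| <= C / y ^+ 2.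
Proof.
(* In [exp y >= y^k / k!], [size p] powers absorb the polynomial and two are left over. *)
pose k := (size p).+2.
exists ((\sum_(i < size p) `|p`_i|) * k`!%:R) => y y1.
have y0 : 0 < y by exact: lt_le_trans y1.
have pb : `|p.[y]| <= (\sum_(i < size p) `|p`_i|) * y ^+ size p.
  rewrite horner_coef mulr_suml; apply: le_trans (ler_norm_sum _ _ _) _.
  apply: ler_sum => i _; rewrite normrM ler_wpM2l// normrX ger0_norm ?(ltW y0)//.
  by apply: ler_weXn2l => //; exact: ltnW.
have eb : expR (- y) <= k`!%:R / y ^+ k.
  rewrite expRN -[leRHS]invrK lef_pV2 ?posrE ?expR_gt0//; last first.
    by rewrite invr_gt0 divr_gt0 ?exprn_gt0// ltr0n fact_gt0.
  rewrite invfM invrK mulrC.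
  by apply: le_trans (expR_ge1Dxn (size p).+1 (ltW y0)); rewrite lerDr.
rewrite normrM (ger0_norm (expR_ge0 _)).
apply: le_trans (ler_pM _ (expR_ge0 _) pb eb) _ => //.
rewrite le_eqVlt; apply/orP; left; apply/eqP.
have yn : y ^+ size p != 0 by rewrite expf_eq0 gt_eqF// andbF.
have y2 : y != 0 by rewrite gt_eqF.
by rewrite /k !exprS expr0; field; rewrite yn y2.
Qed.

(** For [t > 0] the product rule gives [t^-2 (p - p')(1/t) exp(-1/t)]. At [0], [poly_expR_bound]
    with [y = 1/t] is a quadratic bound, so the derivative is [0]. *)
Lemma flat_derive p : (forall t, derivable (flat p) t 1) /\
  derive1 (flat p) = flat ('X^2 * (p - p^`())).
Proof.
suff D : forall t : R, is_derive t 1 (flat p) (flat ('X^2 * (p - p^`())) t).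
  split; last exact: derive1_ext.
  by move=> t; have [] := D t.
move=> t; have [t0|t0|->] := ltgtP t 0.
- apply: (@near_eq_is_derive _ _ _ (cst 0)).
    near=> s; rewrite /flat ltNge ltW//=.
    by near: s; exact: lt_nbhsl.
  by rewrite /flat ltNge ltW//=; exact: is_derive_cst.
- pose g (s : R) := p.[s^-1] * expR (- s^-1).
  apply: (@near_eq_is_derive _ _ _ g).
    near=> s; rewrite /flat ifT//.
    by near: s; exact: lt_nbhsr.
  rewrite /flat t0 /g.
  have tn0 : t != 0 by rewrite gt_eqF.
  have dV : is_derive t 1 (fun s : R => s^-1) (- t ^- 2 *: 1).
    by apply: is_deriveV => //.
  have d1 : is_derive t 1 (horner p \o (fun s : R => s^-1)) (p^`().[t^-1] * (- t ^- 2 *: 1)).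
    exact: is_derive1_comp.
  have d2 : is_derive t 1 (expR \o (fun s : R => - s^-1))
      (expR (- t^-1) * (- (- t ^- 2 *: 1))).
    apply: is_derive1_comp.
  have := is_deriveM d1 d2 => /is_derive_eq; apply.
  rewrite !hornerE /GRing.scale /= exprVn; field.
  by rewrite tn0.
- rewrite [X in is_derive _ _ _ X](_ : _ = 0); last by rewrite /flat ltxx.
  have [C HC] := poly_expR_bound p.
  have C0 : 0 <= C.
    by have := HC 1 (lexx _); rewrite expr1n divr1; exact: le_trans.
  apply: (@is_derive_quadratic _ C) => h h1; rewrite /flat.
  case: ifPn => h0; last by rewrite normr0 mulr_ge0// sqr_ge0.
  apply: le_trans (HC _ _) _; last by rewrite exprVn invrK.
  by rewrite invf_ge1// (le_trans _ h1)// ler_norm.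
Unshelve. all: by end_near. Qed.

Lemma flat_smooth p : smooth1 (flat p).
Proof.
rewrite smooth1P => k; elim: k p => //= k IH p.
by have [? ->] := flat_derive p.
Qed.

Lemma flat1_gt0 t : 0 < t -> 0 < flat 1 t.
Proof. by move=> t0; rewrite /flat t0 hornerC mul1r expR_gt0. Qed.

Lemma flat1_le0 t : t <= 0 -> flat 1 t = 0.
Proof. by rewrite /flat leNgt => /negbTE ->. Qed.

Lemma flat1_ge0 t : 0 <= flat 1 t.
Proof. by have [/flat1_le0->|/flat1_gt0/ltW] := leP t 0. Qed.

(** The quotient [f / (f + g)], where the flat function [f] is positive right of [1/3] and [g] left
    of [2/3], so that the denominator never vanishes. *)
Lemma smooth_step_subproof :
  {H : R -> R | [/\ smooth1 H, forall t, t <= 3^-1 -> H t = 0 &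
                     forall t, 2 / 3 <= t -> H t = 1]}.
Proof.
apply: cid; pose f (t : R) := flat 1 (t - 3^-1); pose g (t : R) := flat 1 (2 / 3 - t).
have fg0 t : f t + g t != 0.
  rewrite gt_eqF// /f /g; have [t0|t0] := ltP (3^-1) t.
    by rewrite ltr_pwDl ?flat1_ge0// flat1_gt0// subr_gt0.
  by rewrite ltr_wpDl ?flat1_ge0// flat1_gt0//; lra.
have sf : smooth1 f by apply: smooth1_shift; exact: flat_smooth.
have sg : smooth1 g.
  rewrite smooth1P => k; apply: (@Cn_comp k (flat 1) (fun t => 2 / 3 - t)).
    exact: (smooth1P _).1 (@flat_smooth 1) k.
  by apply: (@CnD k (cst (2 / 3))); [exact: Cn_cst|apply: CnN; exact: Cn_id].
exists (fun t => f t * (f t + g t)^-1); split=> [|t t3|t t3].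
- apply: (smooth1M sf); rewrite smooth1P => k.
  by apply: CnV => //; have /smooth1P := smooth1D sf sg; exact.
- by rewrite /f flat1_le0 ?mul0r// subr_le0.
- rewrite /g (@flat1_le0 (2 / 3 - t)) ?subr_le0// addr0 divff//.
  by rewrite gt_eqF// /f flat1_gt0//; lra.
Qed.

Definition step : R -> R := sval smooth_step_subproof.

Lemma step_smooth : smooth1 step.
Proof. by rewrite /step; case: smooth_step_subproof => H []. Qed.

Lemma step0 t : t <= 3^-1 -> step t = 0.
Proof. by rewrite /step; case: smooth_step_subproof => H /= [_ + _]; exact. Qed.

Lemma step1 t : 2 / 3 <= t -> step t = 1.
Proof. by rewrite /step; case: smooth_step_subproof => H /= [_ _ +]; exact. Qed.

(** A difference of two translates of the step, so that its integer translates telescope to a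
    partition of unity. *)
Definition cutoff (t : R) : R := step (t + 1) - step t.

Lemma cutoff_smooth : smooth1 cutoff.
Proof.
apply: smooth1D; first by apply: smooth1_shift; exact: step_smooth.
rewrite smooth1P => k; apply: CnN; exact: (smooth1P _).1 step_smooth k.
Qed.

Lemma cutoff_supp t : 2 / 3 <= `|t| -> cutoff t = 0.
Proof.
rewrite ler_normr /cutoff => /orP[t23|t23].
  by rewrite !step1 ?subrr//; lra.
by rewrite !step0 ?subrr//; lra.
Qed.

Lemma cutoff_partition t : - 3^-1 <= t -> t <= 4 / 3 -> cutoff t + cutoff (t - 1) = 1.
Proof.
by move=> t0 t1; rewrite /cutoff subrK addrA subrK step1 ?step0 ?subr0//; lra.
Qed.

(** The binomial coefficient [t (t - 1) ... (t - p + 1) / p!] as a polynomial in [t]. *)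
Definition newton (p : nat) : {poly R} :=
  (p`!%:R)^-1 *: \prod_(i < p) ('X - (i : nat)%:R%:P).

Lemma newtonE p t : (newton p).[t] = (p`!%:R)^-1 * \prod_(i < p) (t - (i : nat)%:R).
Proof.
rewrite /newton hornerZ horner_prod; congr (_ * _).
by apply: eq_bigr => i _; rewrite !hornerE.
Qed.

Lemma newton_pascal p t :
  (newton p.+1).[t] = (newton p.+1).[t - 1] + (newton p).[t - 1].
Proof.
rewrite !newtonE big_ord_recl [in RHS]big_ord_recr /= subr0.
under eq_bigr => i _ do rewrite /bump leq0n natrD opprD addrA.
rewrite factS natrM invfM -natr1.
have p1 : p%:R + 1 != 0 :> R by rewrite natr1 pnatr_eq0.
have pf : (p`!)%:R != 0 :> R by rewrite pnatr_eq0 -lt0n fact_gt0.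
by field; rewrite p1 pf.
Qed.

Lemma newton0 p : (newton p).[0] = (p == 0%N)%:R.
Proof.
rewrite newtonE; case: p => [|p]; first by rewrite big_ord0 fact0 invr1 mulr1.
by rewrite big_ord_recl /= subr0 mul0r mulr0.
Qed.

Lemma newton_deriv0 p a t : (p < a)%N -> (newton p)^`(a).[t] = 0.
Proof.
move=> pa; suff -> : (newton p)^`(a) = 0 by rewrite horner0.
apply: derivn_poly0; apply: leq_trans pa.
apply: leq_trans (size_scale_leq _ _) _.
by rewrite size_prod_XsubC /index_enum/= -enumT size_enum_ord.
Qed.

Definition wt (p : nat) (t : R) : R := cutoff t * (newton p).[t].

Lemma wt_smooth p : smooth1 (wt p).
Proof. by apply: smooth1M; [exact: cutoff_smooth|exact: (smooth1_poly _).1]. Qed.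

Lemma wt_supp p a t : 2 / 3 < `|t| -> derive1n a (wt p) t = 0.
Proof.
move=> t23; have : {near t, wt p =1 (fun=> 0)}.
  near=> s; rewrite /wt cutoff_supp ?mul0r//; apply: ltW.
  near: s; have := @norm_continuous _ _ t.
  move=> /cvgr_gt; apply; exact: t23.
move=> /(near_derive1n a) /nbhs_singleton ->.
by rewrite derive1n_cst0.
Unshelve. all: by end_near. Qed.

Lemma wt_bounded p a : exists C, forall t, `|derive1n a (wt p) t| <= C.
Proof.
have cf : continuous (fun t => `|derive1n a (wt p) t|).
  move=> t; apply: (continuous_comp (@smooth1_continuous a _ (@wt_smooth p) t)).
  exact: norm_continuous.
have [c _ fc] := @EVT_max R (fun t => `|derive1n a (wt p) t|) (-1) 1
  ltac:(lra) (continuous_subspaceT cf).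
exists `|derive1n a (wt p) c| => t; have [t1|t1] := leP `|t| 1.
  by apply: fc; rewrite in_itv/= -ler_norml.
by rewrite wt_supp ?normr0//; apply: le_lt_trans t1; lra.
Qed.

(** Nonzero integers lie outside the support of [cutoff], and [newton p] vanishes at [0] for
    [p > 0]. This makes the extension interpolate on the lattice. *)
Lemma wt_int p (z : int) : wt p z%:~R = ((z == 0) && (p == 0%N))%:R.
Proof.
have [->|z0] := eqVneq z 0.
  rewrite /wt newton0 /= [X in X * _](_ : _ = 1) ?mul1r//.
  by rewrite /cutoff add0r step1 ?step0 ?subr0//; lra.
rewrite /wt cutoff_supp ?mul0r// -intr_norm; apply: (@le_trans _ _ 1); first lra.
by rewrite -[leLHS]/(1%:~R) ler_int -gtz0_ge1 normr_gt0.
Qed.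

(** Pascal's rule turns the terms at [u - 1] into [cutoff (u - 1)] times [newton p] at [u], and the
    two cutoffs add up to [1]. *)
Lemma wt_newton p a (u : R) : 0 <= u -> u <= 1 ->
  derive1n a (wt p) u + derive1n a (wt p) (u - 1) +
    (if p is p'.+1 then derive1n a (wt p') (u - 1) else 0) = (newton p)^`(a).[u].
Proof.
move=> u0 u1; have [g gE] : exists g, g = if p is p'.+1 then wt p' else fun=> 0 by eexists.
have sg : smooth1 g.
  rewrite gE; case: p {gE} => [|p']; last exact: wt_smooth.
  by rewrite smooth1P => k; exact: Cn_cst.
have -> : (if p is p'.+1 then derive1n a (wt p') (u - 1) else 0) =
    derive1n a g (u - 1).
  by rewrite gE; case: p {gE} => //; rewrite derive1n_cst0.
have := @derive1n_shift a (wt p) (- 1) => /(congr1 (fun f => f u)) <-.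
have := @derive1n_shift a g (- 1) => /(congr1 (fun f => f u)) <-.
pose F := (wt p \+ (fun s => wt p (s - 1))) \+ (fun s => g (s - 1)).
transitivity (derive1n a F u).
  have sw := @wt_smooth p.
  have sw1 := @smooth1_shift _ (- 1) sw.
  have sg1 := @smooth1_shift _ (- 1) sg.
  rewrite /F (derive1nD a (smooth1D sw sw1) sg1) (derive1nD a sw sw1).
  reflexivity.
have [_ /(_ a) /(congr1 (fun f => f u)) <-] := smooth1_poly (newton p).
suff : {near u, F =1 (fun t => (newton p).[t])}.
  by move=> /(near_derive1n a) /nbhs_singleton.
(* The partition identity holds on [[-1/3, 4/3]], a neighbourhood of [[0, 1]], so it may be
   differentiated at the end points as well. *)
near=> s; rewrite /F /= gE /wt.
have s0 : - 3^-1 <= s.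
  by apply: ltW; near: s; apply: lt_nbhsr; lra.
have s1 : s <= 4 / 3.
  by apply: ltW; near: s; apply: lt_nbhsl; lra.
have := cutoff_partition s0 s1.
case: p {gE F} => [|p'].
  have E t : (newton 0).[t] = 1 by rewrite newtonE big_ord0 fact0 invr1 mulr1.
  by rewrite !E !mulr1 addr0.
move=> E; rewrite -addrA -mulrDr -newton_pascal -mulrDl E mul1r//.
Unshelve. all: by end_near. Qed.

End Smooth1.

(** * Reduction to real-valued functions *)

Section MultiIndexLists.
Variable n : nat.

(** Turns multi-index powers of operators into folds over a list of coordinates, which are
    accessible to induction. *)
Definition mlist (alpha : 'I_n -> nat) : seq 'I_n :=
  flatten [seq nseq (alpha i) i | i <- enum 'I_n].

Lemma mpowE (T : Type) (D : 'I_n -> T -> T) alpha (f : T) :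
  mpow D alpha f = foldr D f (mlist alpha).
Proof.
rewrite /mpow /mlist enumT /index_enum/= -enumT.
elim: (enum 'I_n) => [|i s IH]; first by rewrite big_nil.
rewrite big_cons foldr_cat /= IH.
by elim: (alpha i) => //= a ->.
Qed.

Lemma size_mlist alpha : size (mlist alpha) = mabs alpha.
Proof.
rewrite size_flatten sumnE /shape -map_comp big_map /mabs big_enum /=.
by apply: eq_bigr => i _; rewrite size_nseq.
Qed.

Lemma count_mlist alpha i : count_mem i (mlist alpha) = alpha i.
Proof.
rewrite count_flatten -map_comp sumnE big_map big_enum /= (bigD1 i)//=.
rewrite count_nseq /= eqxx mul1n big1 ?addn0// => j ji.
by rewrite count_nseq /= (negbTE ji).
Qed.

End MultiIndexLists.

Section RealParts.
Variable R : realType.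

(** With [rsmooth], the real-valued counterpart of [cderive] and [csmooth]: all the analysis is done
    on real and imaginary parts separately. *)
Definition pd (V : normedModType R) (I : Type) (e : I -> V) (s : seq I)
  (f : V -> R) : V -> R := foldr (fun i g z => 'D_(e i) g z) f s.

Definition rsmooth (V : normedModType R) (I : Type) (e : I -> V) (f : V -> R) :=
  forall s, continuous (pd e s f) /\ forall i z, derivable (pd e s f) z (e i).

Lemma Re_pd (V : normedModType R) (I : Type) (e : I -> V) s (f : V -> R[i]) z :
  complex.Re (foldr (fun i => cderive (e i)) f s z) =
  pd e s (fun y => complex.Re (f y)) z.
Proof.
by elim: s z => //= i s IH z; congr ('D_(e i) _ z); apply/funext.
Qed.

Lemma Im_pd (V : normedModType R) (I : Type) (e : I -> V) s (f : V -> R[i]) z :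
  complex.Im (foldr (fun i => cderive (e i)) f s z) =
  pd e s (fun y => complex.Im (f y)) z.
Proof.
by elim: s z => //= i s IH z; congr ('D_(e i) _ z); apply/funext.
Qed.

Lemma csmoothP (V : normedModType R) (I : Type) (e : I -> V) (f : V -> R[i]) :
  csmooth e f <-> rsmooth e (fun y => complex.Re (f y)) /\
                  rsmooth e (fun y => complex.Im (f y)).
Proof.
have ReE s : (fun z => complex.Re (foldr (fun i => cderive (e i)) f s z)) =
  pd e s (fun y => complex.Re (f y)) by apply/funext => z; exact: Re_pd.
have ImE s : (fun z => complex.Im (foldr (fun i => cderive (e i)) f s z)) =
  pd e s (fun y => complex.Im (f y)) by apply/funext => z; exact: Im_pd.
split=> [fs|[rs js] s].
  split=> s; have [[]] := fs s; rewrite ReE ImE => cr ci d; split=> // i z.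
    by have [+ _] := d i z; rewrite ReE.
  by have [_] := d i z; rewrite ImE.
rewrite /ccontinuous /cderivable; rewrite ReE ImE.
by split=> [|i z]; split; by [case: (rs s)|case: (js s)].
Qed.

Lemma complex_bound (z : R[i]) (c : R) :
  `|z| <= c%:C -> `|complex.Re z| <= c /\ `|complex.Im z| <= c.
Proof.
move=> zc; split; rewrite -lecR; apply: le_trans zc.
  exact: normc_ge_Re.
by case: z => a b; simpc; rewrite -sqrtr_sqr ler_wsqrtr // lerDr sqr_ge0.
Qed.

Lemma complex_norm_le (z : R[i]) (c : R) :
  `|complex.Re z| + `|complex.Im z| <= c -> `|z| <= c%:C.
Proof.
case: z => a b /= abc; simpc; apply: le_trans abc.
rewrite -[leRHS]ger0_norm ?addr_ge0// -sqrtr_sqr ler_wsqrtr//.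
rewrite -[X in X + _ <= _](@real_normK _ a) ?num_real//.
rewrite -[X in _ + X <= _](@real_normK _ b) ?num_real//.
by rewrite sqrrD -addrA (addrC (_ *+ 2)) addrA lerDl mulrn_wge0// mulr_ge0.
Qed.

Variable n : nat.

Definition rdiff (j : 'I_n) (sigma : 'rV[int]_n -> R) : 'rV[int]_n -> R :=
  fun k => sigma (k + delta_mx 0 j) - sigma k.

Lemma Re_fdiff s (f : 'rV[int]_n -> R[i]) k :
  complex.Re (foldr (@fdiff R n) f s k) = foldr rdiff (fun l => complex.Re (f l)) s k.
Proof.
by elim: s k => //= i s IH k; rewrite /rdiff -!IH /fdiff raddfB.
Qed.

Lemma Im_fdiff s (f : 'rV[int]_n -> R[i]) k :
  complex.Im (foldr (@fdiff R n) f s k) = foldr rdiff (fun l => complex.Im (f l)) s k.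
Proof.
by elim: s k => //= i s IH k; rewrite /rdiff -!IH /fdiff raddfB.
Qed.

End RealParts.

(** * Partial derivatives, restriction to lines, and slices in [x] and in [xi] *)

Section PartialDerivatives.
Variable R : realType.

Section General.
Variables (V : normedModType R) (I : Type) (e : I -> V).
Implicit Types (f g : V -> R) (s : seq I).

Lemma pd_cat s1 s2 f : pd e (s1 ++ s2) f = pd e s1 (pd e s2 f).
Proof. by rewrite /pd foldr_cat. Qed.

Lemma rsmooth_pd s f : rsmooth e f -> rsmooth e (pd e s f).
Proof. by move=> sf s'; rewrite -pd_cat. Qed.

Lemma pdB s f g : rsmooth e f -> rsmooth e g ->
  pd e s (f \- g) = pd e s f \- pd e s g.
Proof.
move=> sf sg; elim: s => //= i s IH.
apply/funext => z /=; rewrite IH deriveB //; first exact: (sf s).2.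
exact: (sg s).2.
Qed.

Lemma rsmoothB f g : rsmooth e f -> rsmooth e g -> rsmooth e (f \- g).
Proof.
move=> sf sg s; rewrite pdB//; split=> [z|i z].
  by apply: continuousB; [exact: (sf s).1|exact: (sg s).1].
by apply: derivableB; [exact: (sf s).2|exact: (sg s).2].
Qed.

Lemma is_derive_line f (v z : V) (t : R) :
  derivable f (t *: v + z) v ->
  is_derive t 1 (fun t => f (t *: v + z)) ('D_v f (t *: v + z)).
Proof.
rewrite /derivable; set G := (X in cvg (X @ _)) => df.
have E : (fun h : R => h^-1 *:
    (((fun t => f (t *: v + z)) \o shift t) (h *: (1 : R)) - f (t *: v + z))) = G.
  by apply/funext => h; rewrite /G /= [h%:A]mulr1 scalerDl addrA.
by apply: DeriveDef; rewrite /derivable /derive E.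
Qed.

Lemma mvt_line f (v z : V) (b : R) : (forall y, derivable f y v) -> 0 <= b ->
  exists2 c, 0 <= c <= b & f (b *: v + z) - f z = 'D_v f (c *: v + z) * b.
Proof.
move=> df b0.
have D (t : R) := @is_derive_line f v z t (df _).
have [|c] := @MVT_segment R (fun t => f (t *: v + z)) _ 0 b b0 (fun t _ => D t).
  apply: continuous_subspaceT => t; apply: differentiable_continuous.
  by apply/derivable1_diffP; have [] := D t.
by rewrite in_itv/= scale0r add0r subr0 => cb E; exists c.
Qed.

End General.

Variable n : nat.
Implicit Types (b : 'rV[R]_n * 'rV[R]_n -> R) (x xi : 'rV[R]_n).

(** The difference quotients agree as functions of [h], so existence and value of the derivative
    pass to the slice together. *)
Lemma quotient_inl b j x xi :
  (fun h : R => h^-1 *: ((b \o shift (x, xi)) (h *: @unitxxi R n (inl j)) - b (x, xi))) =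
  (fun h : R => h^-1 *:
    (((fun y => b (y, xi)) \o shift x) (h *: @unitv R n j) - b (x, xi))).
Proof.
apply/funext => h /=; congr (_ *: (b _ - _)).
by rewrite -[LHS]/(h *: unitv R j + x, h *: (0 : 'rV[R]_n) + xi) scaler0 add0r.
Qed.

Lemma derive_inl b j x xi :
  'D_(@unitxxi R n (inl j)) b (x, xi) = 'D_(unitv R j) (fun y => b (y, xi)) x.
Proof. by rewrite /derive quotient_inl. Qed.

Lemma derivable_inl b j x xi :
  derivable b (x, xi) (@unitxxi R n (inl j)) <->
  derivable (fun y => b (y, xi)) x (unitv R j).
Proof. by rewrite /derivable quotient_inl. Qed.

Lemma quotient_inr b j x xi :
  (fun h : R => h^-1 *: ((b \o shift (x, xi)) (h *: @unitxxi R n (inr j)) - b (x, xi))) =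
  (fun h : R => h^-1 *:
    (((fun y => b (x, y)) \o shift xi) (h *: @unitv R n j) - b (x, xi))).
Proof.
apply/funext => h /=; congr (_ *: (b _ - _)).
by rewrite -[LHS]/(h *: (0 : 'rV[R]_n) + x, h *: unitv R j + xi) scaler0 add0r.
Qed.

Lemma derive_inr b j x xi :
  'D_(@unitxxi R n (inr j)) b (x, xi) = 'D_(unitv R j) (fun y => b (x, y)) xi.
Proof. by rewrite /derive quotient_inr. Qed.

Lemma derivable_inr b j x xi :
  derivable b (x, xi) (@unitxxi R n (inr j)) <->
  derivable (fun y => b (x, y)) xi (unitv R j).
Proof. by rewrite /derivable quotient_inr. Qed.

Lemma pd_inl s b x xi :
  pd (@unitxxi R n) (map inl s) b (x, xi) = pd (@unitv R n) s (fun y => b (y, xi)) x.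
Proof.
elim: s x => //= j s IH x; rewrite derive_inl; congr ('D_(unitv R j) _ x).
by apply/funext => y.
Qed.

Lemma pd_inr s b x xi :
  pd (@unitxxi R n) (map inr s) b (x, xi) = pd (@unitv R n) s (fun y => b (x, y)) xi.
Proof.
elim: s xi => //= j s IH xi; rewrite derive_inr; congr ('D_(unitv R j) _ xi).
by apply/funext => y.
Qed.

Lemma rsmooth_slicex b xi : rsmooth (@unitxxi R n) b ->
  rsmooth (@unitv R n) (fun y => b (y, xi)).
Proof.
move=> sb s; have [cb db] := sb (map inl s).
have E : pd (@unitv R n) s (fun y => b (y, xi)) =
  (fun y => pd (@unitxxi R n) (map inl s) b (y, xi)).
  by apply/funext => y; rewrite pd_inl.
rewrite E; split=> [x|i x]; last by rewrite -derivable_inl; exact: db.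
apply: (@cvg_comp _ _ _ (fun y => (y, xi)) (pd _ _ b) (nbhs x) (nbhs (x, xi)) _ _ (cb _)).
exact: (@cvg_pair _ _ _ (nbhs x) (nbhs x) (nbhs xi) _ _ _ id (fun=> xi) cvg_id (cvg_cst _)).
Qed.

Lemma rsmooth_slicexi b x : rsmooth (@unitxxi R n) b ->
  rsmooth (@unitv R n) (fun y => b (x, y)).
Proof.
move=> sb s; have [cb db] := sb (map inr s).
have E : pd (@unitv R n) s (fun y => b (x, y)) =
  (fun y => pd (@unitxxi R n) (map inr s) b (x, y)).
  by apply/funext => y; rewrite pd_inr.
rewrite E; split=> [xi|i xi]; last by rewrite -derivable_inr; exact: db.
apply: (@cvg_comp _ _ _ (fun y => (x, y)) (pd _ _ b) (nbhs xi) (nbhs (x, xi)) _ _ (cb _)).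
exact: (@cvg_pair _ _ _ (nbhs xi) (nbhs x) (nbhs xi) _ _ _ (fun=> x) id (cvg_cst _) cvg_id).
Qed.

End PartialDerivatives.

(** * Comparison of the weights at points of bounded distance *)

Section Japanese.
Variables (R : realType) (n : nat).
Implicit Types xi eta : 'rV[R]_n.

Lemma japanese_ge1 xi : 1 <= japanese xi.
Proof.
by rewrite -[leLHS]sqrtr1 ler_wsqrtr// lerDl sumr_ge0// => i _; exact: sqr_ge0.
Qed.

Lemma japanese_gt0 xi : 0 < japanese xi.
Proof. exact: lt_le_trans (japanese_ge1 xi). Qed.

(** Rests on the coordinatewise inequality [a^2 <= 2 b^2 + 2 M^2] for [|a - b| <= M], summed over
    the [n] coordinates. *)
Lemma japanese_near (M : R) : exists2 K : R, 1 <= K &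
  forall xi eta, (forall i, `|xi 0 i - eta 0 i| <= M) -> japanese xi <= K * japanese eta.
Proof.
exists (Num.sqrt (2 * (1 + n%:R * M ^+ 2))) => [|xi eta xe].
  rewrite -[leLHS]sqrtr1 ler_wsqrtr//.
  have : 0 <= n%:R * M ^+ 2 by rewrite mulr_ge0// sqr_ge0.
  lra.
rewrite /japanese -sqrtrM; last first.
  by rewrite mulr_ge0// addr_ge0// mulr_ge0// sqr_ge0.
rewrite ler_wsqrtr//.
have le1 : \sum_(i < n) xi 0 i ^+ 2 <= 2 * \sum_(i < n) eta 0 i ^+ 2 + 2 * (n%:R * M ^+ 2).
  have -> : n%:R * M ^+ 2 = \sum_(i < n) M ^+ 2 by rewrite sumr_const card_ord mulr_natl.
  rewrite -mulrDr -big_split mulr_sumr; apply: ler_sum => i _ /=.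
  have : (xi 0 i - eta 0 i) ^+ 2 <= M ^+ 2.
    by rewrite -real_normK ?num_real// lerXn2r ?nnegrE// (le_trans _ (xe i)).
  move: (xi 0 i) (eta 0 i) => a b; rewrite sqrrB => ab.
  (* After doubling [(a - b)^2 <= M^2], the claim reduces to [(a - 2 b)^2 >= 0]. *)
  have := sqr_ge0 (a - 2 * b); nra.
have S0 : 0 <= \sum_(i < n) eta 0 i ^+ 2 by apply: sumr_ge0 => i _; exact: sqr_ge0.
have N0 : 0 <= n%:R * M ^+ 2 by rewrite mulr_ge0// sqr_ge0.
move: (\sum_(i < n) xi 0 i ^+ 2) (\sum_(i < n) eta 0 i ^+ 2) (n%:R * M ^+ 2) le1 S0 N0 => a b c.
nra.
Qed.

(** The hypothesis is symmetric in [xi] and [eta], so for negative [s] the comparison is used with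
    the two points exchanged. *)
Lemma japanese_pow_near (M s : R) : exists2 c : R, 0 < c &
  forall xi eta, (forall i, `|xi 0 i - eta 0 i| <= M) ->
    japanese xi `^ s <= c * japanese eta `^ s.
Proof.
have [K K1 HK] := japanese_near M.
have K0 : 0 < K by exact: lt_le_trans K1.
exists (K `^ `|s|) => [|xi eta xe]; first exact: powR_gt0.
have [s0|s0] := leP 0 s.
  rewrite ger0_norm// -powRM ?(ltW K0) ?(ltW (japanese_gt0 _))//.
  by rewrite ge0_ler_powR ?nnegrE ?mulr_ge0 ?(ltW K0) ?(ltW (japanese_gt0 _))// HK.
rewrite ltr0_norm//; have [r r0 ->] : exists2 r, 0 < r & s = - r.
  by exists (- s); rewrite ?opprK ?oppr_gt0.
rewrite opprK !powRN ler_pdivlMr ?powR_gt0 ?japanese_gt0// mulrC.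
rewrite ler_pdivrMr ?powR_gt0 ?japanese_gt0// -powRM ?(ltW K0) ?(ltW (japanese_gt0 _))//.
rewrite ge0_ler_powR ?nnegrE ?mulr_ge0 ?(ltW K0) ?(ltW (japanese_gt0 _)) ?(ltW r0)//.
by apply: HK => i; rewrite distrC.
Qed.

End Japanese.

(** * Differences and derivatives *)

Section Increments.
Variables (R : realType) (n : nat).
Local Notation V := 'rV[R]_n.
Local Notation e := (@unitv R n).
Implicit Types (F : V -> R) (xi eta : V) (s : seq 'I_n).

Definition incr (j : 'I_n) F : V -> R := fun xi => F (xi + e j) - F xi.

Lemma derive_shift F (a v xi : V) :
  'D_v (fun y => F (y + a)) xi = 'D_v F (xi + a).
Proof.
rewrite /derive (_ : (fun h : R => _) =
  (fun h => h^-1 *: ((F \o shift (xi + a)) (h *: v) - F (xi + a))))//.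
by apply/funext => h /=; rewrite addrA.
Qed.

Lemma derivable_shift F (a v xi : V) :
  derivable F (xi + a) v -> derivable (fun y => F (y + a)) xi v.
Proof.
rewrite /derivable (_ : (fun h : R => h^-1 *: ((F \o shift (xi + a)) _ - _)) =
   (fun h => h^-1 *: (((fun y => F (y + a)) \o shift xi) (h *: v) - F (xi + a))))//.
by apply/funext => h /=; rewrite addrA.
Qed.

Lemma pd_shift s F a : pd e s (fun y => F (y + a)) = (fun y => pd e s F (y + a)).
Proof.
by elim: s => //= j s ->; apply/funext => y; rewrite derive_shift.
Qed.

Lemma rsmooth_shift F a : rsmooth e F -> rsmooth e (fun y => F (y + a)).
Proof.
move=> sF s; rewrite pd_shift; split=> [y|i y]; last first.
  by apply: derivable_shift; exact: (sF s).2.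
apply: (@cvg_comp _ _ _ (fun y => y + a) (pd e s F) (nbhs y) (nbhs (y + a)) _ _ ((sF s).1 _)).
by apply: cvgD; [exact: cvg_id|exact: cvg_cst].
Qed.

Lemma rsmooth_incr j F : rsmooth e F -> rsmooth e (incr j F).
Proof. move=> sF; exact: (rsmoothB (rsmooth_shift (e j) sF) sF). Qed.

Lemma pd_incr s j F : rsmooth e F -> pd e s (incr j F) = incr j (pd e s F).
Proof.
move=> sF; apply: eq_trans (pdB s (rsmooth_shift (e j) sF) sF) _.
by rewrite pd_shift.
Qed.

Lemma foldr_incrC s j F : foldr incr (incr j F) s = incr j (foldr incr F s).
Proof.
elim: s => //= i s ->; apply/funext => xi; rewrite /incr.
by rewrite (addrAC xi (e j)); ring.
Qed.

Lemma incr_mean s F xi : rsmooth e F -> exists2 theta : V,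
  forall j, 0 <= theta 0 j <= (count_mem j s)%:R &
  foldr incr F s xi = pd e s F (xi + theta).
Proof.
elim: s F => [|i s IH] F sF; first by exists 0 => [j|]; rewrite ?mxE ?lexx ?addr0.
have [th th0 /=] := IH _ (rsmooth_incr i sF).
rewrite foldr_incrC pd_incr// => ->.
have [c /andP[c0 c1]] := mvt_line (xi + th) (fun y => (sF s).2 i y) ler01.
rewrite scale1r mulr1 [e i + _]addrC /incr => ->.
exists (th + c *: e i); last by rewrite addrC addrA.
move=> j; have /andP[t0 t1] := th0 j.
rewrite !mxE eqxx /= eq_sym addr_ge0 ?mulr_ge0 ?ler0n//= addrC natrD lerD//.
by case: eqVneq => _; rewrite ?mulr1// mulr0.
Qed.

Lemma latt_succ (k : 'rV[int]_n) j : latt R (k + delta_mx 0 j) = latt R k + e j.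
Proof.
by apply/matrixP => a b; rewrite !mxE intrD; congr (_ + _); case: (_ && _).
Qed.

Lemma foldr_rdiff s F k :
  foldr (@rdiff R n) (fun l => F (latt R l)) s k = foldr incr F s (latt R k).
Proof.
elim: s k => //= j s IH k; by rewrite /rdiff !IH latt_succ.
Qed.

End Increments.

(** * Restriction of real symbols to the lattice, and decay of symbols vanishing there *)

Section RealSymbols.
Variables (R : realType) (n : nat) (m rho delta : R).
Local Notation V := 'rV[R]_n.
Local Notation e := (@unitv R n).
Local Notation E := (@unitxxi R n).

Definition tbound (u : V -> 'rV[int]_n -> R) : Prop :=
  forall alpha beta : 'I_n -> nat, exists C : R, forall x k,
    `|foldr (@rdiff R n) (fun l => pd e (mlist beta) (u^~ l) x) (mlist alpha) k| <=
    C * japanese (latt R k) `^ (m - rho * (mabs alpha)%:R + delta * (mabs beta)%:R).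

Definition ebound (b : V * V -> R) : Prop :=
  forall alpha beta : 'I_n -> nat, exists C : R, forall x xi,
    `|pd E (map inr (mlist alpha) ++ map inl (mlist beta)) b (x, xi)| <=
    C * japanese xi `^ (m - rho * (mabs alpha)%:R + delta * (mabs beta)%:R).

(** By [incr_mean] a difference of order [|alpha|] is a derivative at a point within [|alpha|] of
    the lattice point in each coordinate, where the weights are comparable. *)
Lemma ebound_restrict b : rsmooth E b -> ebound b ->
  tbound (fun x k => b (x, latt R k)).
Proof.
move=> sb bb al be; have [C HC] := bb al be.
set s := _ + _ in HC *.
have [c c0 Hc] := @japanese_pow_near R n (mabs al)%:R s.
exists (`|C| * c) => x k.
pose F xi := pd E (map inl (mlist be)) b (x, xi).
have sF : rsmooth e F by apply: rsmooth_slicexi; exact: rsmooth_pd.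
have -> : (fun l => pd e (mlist be) (fun y => b (y, latt R l)) x) =
    (fun l => F (latt R l)).
  by apply/funext => l; rewrite /F pd_inl.
rewrite foldr_rdiff; have [th th0 ->] := incr_mean (mlist al) (latt R k) sF.
rewrite -pd_inr -pd_cat; apply: le_trans (HC _ _) _.
apply: (@le_trans _ _ (`|C| * japanese (latt R k + th) `^ s)).
  by rewrite ler_wpM2r ?powR_ge0// ler_norm.
rewrite -mulrA ler_wpM2l// Hc// => i; 
have -> : (latt R k + th) 0 i - latt R k 0 i = th 0 i by rewrite mxE; ring.
have /andP[t0 t1] := th0 i; rewrite ger0_norm//; apply: le_trans t1 _.
by rewrite ler_nat -size_mlist count_size.
Qed.

(* The [q]-th difference, which is small, is a value of the [q]-th derivative
   along the segment; the other values are reached by integrating the bound on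
   the next derivative, downwards from [q = M]. *)
Lemma pd_nseq_small F (i : 'I_n) (M : nat) (eps B : R) (eta : V) :
  rsmooth e F -> 0 <= eps -> 0 <= B ->
  (forall j, (j <= M)%N -> `|F (j%:R *: e i + eta)| <= eps) ->
  (forall t, 0 <= t <= M%:R -> `|pd e (nseq M i) F (t *: e i + eta)| <= B) ->
  forall q t, (q <= M)%N -> 0 <= t <= M%:R ->
    `|pd e (nseq q i) F (t *: e i + eta)| <= M.+2%:R ^+ (M - q) * (2 ^+ M * eps + B).
Proof.
move=> sF eps0 B0 Feps FB q t qM.
have A0 : 0 <= 2 ^+ M * eps + B by rewrite addr_ge0// mulr_ge0// exprn_ge0.
(* A [q']-th difference is a signed sum of [2^q'] values at integer points, counted with
   multiplicity. *)
have diff_le q' a : (a + q' <= M)%N ->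
    `|foldr (@incr R n) F (nseq q' i) (a%:R *: e i + eta)| <= 2 ^+ q' * eps.
  elim: q' a => [|q' IH] a aM /=; first by rewrite expr0 mul1r Feps// -(addn0 a).
  rewrite /incr exprS -mulrA mulr_natl mulr2n; apply: le_trans (ler_normB _ _) _.
  apply: lerD; last by apply: IH; rewrite (leq_trans _ aM)// leq_add2l.
  have -> : a%:R *: e i + eta + e i = a.+1%:R *: e i + eta.
    by rewrite -natr1 scalerDl scale1r addrAC.
  by apply: IH; rewrite addSnnS.
pose A := 2 ^+ M * eps + B.
suff key d q' t' : (q' + d = M)%N -> 0 <= t' <= M%:R ->
    `|pd e (nseq q' i) F (t' *: e i + eta)| <= M.+2%:R ^+ d * A.
  by move=> tM; apply: key => //; rewrite subnKC.
elim: d q' t' => [|d IH] q' t'.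
  rewrite addn0 => -> tM; rewrite expr0 mul1r; apply: le_trans (FB _ tM) _.
  by rewrite lerDr mulr_ge0// exprn_ge0.
rewrite addnS -addSn => qdM /andP[t0 tM].
have q'M : (q' <= M)%N by rewrite -qdM addSn -addnS leq_addr.
have [th th0 Eth] := incr_mean (nseq q' i) eta sF.
have thE : eta + th = th 0 i *: e i + eta.
  rewrite addrC; congr (_ + _); apply/matrixP => a j; rewrite ord1 !mxE eqxx /=.
  case: eqVneq => [->|ji]; first by rewrite mulr1.
  rewrite mulr0; apply/eqP; rewrite eq_le andbC; have := th0 j.
  by rewrite count_nseq /= (negbTE (_ : i != j)) ?mul0n// eq_sym.
have /andP[c0 cM] : 0 <= th 0 i <= M%:R.
  have /andP[-> /= h] := th0 i; apply: le_trans h _.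
  by rewrite ler_nat count_nseq /= eqxx mul1n.
set c := th 0 i in thE c0 cM.
(* At [c] the derivative equals the [q']-th difference at [eta]; every other point of the segment is
   reached from [c]. *)
have vc : `|pd e (nseq q' i) F (c *: e i + eta)| <= A.
  rewrite -thE -Eth -[eta](add0r eta) -(scale0r (e i)).
  apply: le_trans (diff_le q' 0%N _) _ => //.
  apply: (@le_trans _ _ (2 ^+ M * eps)); last by rewrite lerDl.
  by rewrite ler_wpM2r// ler_weXn2l// ler1n.
pose D := M.+2%:R ^+ d * A.
have D0 : 0 <= D by rewrite mulr_ge0// exprn_ge0.
have incr_le a b : 0 <= a -> a <= b -> b <= M%:R ->
    `|pd e (nseq q' i) F (b *: e i + eta) - pd e (nseq q' i) F (a *: e i + eta)| <=
    M%:R * D.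
  move=> a0 ab bM; have ba0 : 0 <= b - a by rewrite subr_ge0.
  have [r /andP[r0 rb]] := mvt_line (a *: e i + eta) ((sF (nseq q' i)).2 i) ba0.
  rewrite addrA -scalerDl subrK => ->; rewrite addrA -scalerDl normrM mulrC.
  rewrite (ger0_norm ba0) ler_pM//; first by lra.
  by apply: (IH q'.+1); [exact: qdM|lra].
have dD : `|pd e (nseq q' i) F (t' *: e i + eta) - pd e (nseq q' i) F (c *: e i + eta)|
    <= M%:R * D.
  by have [ct|/ltW tc] := leP c t'; [|rewrite distrC]; exact: incr_le.
have -> : pd e (nseq q' i) F (t' *: e i + eta) =
    (pd e (nseq q' i) F (t' *: e i + eta) - pd e (nseq q' i) F (c *: e i + eta)) +
    pd e (nseq q' i) F (c *: e i + eta) by rewrite subrK.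
apply: le_trans (ler_normD _ _) _; apply: le_trans (lerD dD vc) _.
(* The sum [M * D + A] fits into [(M + 2) * D] because [A <= D]. *)
rewrite exprS -mulrA -/D -natr1 -natr1 -addrA mulrDl lerD2l.
have AD : A <= D by rewrite ler_peMl// exprn_ege1// ler1n.
by rewrite mulrDl mul1r (le_trans AD)// lerDl.
Qed.

(** [mlist] lists coordinates in increasing order, so the first coordinate present can be peeled off
    as the outermost derivatives. *)
Lemma mlist_split alpha (i : 'I_n) : (forall j : 'I_n, (j < i)%N -> alpha j = 0%N) ->
  mlist alpha = nseq (alpha i) i ++ mlist (fun j => if j == i then 0%N else alpha j).
Proof.
move=> a0; have : pairwise (relpre val ltn) (enum 'I_n).
  rewrite -pairwise_map val_enum_ord -sorted_pairwise ?iota_ltn_sorted//.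
  exact: ltn_trans.
have := enum_uniq 'I_n; rewrite /mlist.
have /splitPr[p1 p2] : i \in enum 'I_n by rewrite mem_enum.
rewrite cat_uniq /= => /and3P[_ _ /andP[ip2 _]].
rewrite pairwise_cat => /and3P[/allrelP p1i _ _].
have nil (f : 'I_n -> nat) : (forall j : 'I_n, (j < i)%N -> f j = 0%N) ->
    flatten [seq nseq (f j) j | j <- p1] = [::].
  move=> f0; elim: p1 p1i => //= j p1 IH p1i; rewrite f0 ?IH//.
    by move=> k l kp1 lp2; apply: p1i => //; rewrite inE kp1 orbT.
  by apply: p1i; rewrite inE eqxx.
rewrite !map_cat !flatten_cat /= eqxx /= !nil ?cat0s// => [|j ji]; last by rewrite a0 ?if_same.
congr (_ ++ flatten _); apply/eq_in_map => j jp2.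
by case: eqVneq jp2 ip2 => // -> ->.
Qed.

Lemma mlist0 (alpha : 'I_n -> nat) : (forall j, alpha j = 0%N) -> mlist alpha = [::].
Proof.
by move=> a0; rewrite /mlist; elim: (enum 'I_n) => //= j s ->; rewrite a0.
Qed.

Lemma pd0 (W : normedModType R) (I : Type) (v : I -> W) s : pd v s (fun=> 0) = fun=> 0.
Proof.
by elim: s => //= i s ->; apply/funext => y; rewrite derive_cst.
Qed.

Lemma ebound_vanish c : 0 < rho -> rsmooth E c -> ebound c ->
  (forall x k, c (x, latt R k) = 0) ->
  forall (alpha beta : 'I_n -> nat) (N : nat), exists C : R, forall x xi,
    `|pd E (map inr (mlist alpha) ++ map inl (mlist beta)) c (x, xi)| <=
    C * japanese xi `^ (- N%:R).
Proof.
move=> rho0 sc bc c0.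
(* The induction frees the real coordinates from the last one on, so that the
   derivative in the coordinate just freed is outermost in [mlist alpha]. *)
suff key (d : nat) : forall i, (i + d)%N = n -> forall alpha beta : 'I_n -> nat,
    (forall j : 'I_n, (j < i)%N -> alpha j = 0%N) -> forall N : nat,
    exists2 C : R, 0 <= C & forall x xi : V,
      (forall j : 'I_n, (j < i)%N -> exists z : int, xi 0 j = z%:~R) ->
      `|pd E (map inr (mlist alpha) ++ map inl (mlist beta)) c (x, xi)| <=
      C * japanese xi `^ (- N%:R).
  move=> al be N; have [C _ HC] := key n 0%N (add0n n) al be (fun _ => ltac:(done)) N.
  by exists C => x xi; apply: HC.
elim: d => [|d IH] i.
  (* No free coordinate: [xi] is a lattice point and [alpha] is zero, so only [x]-derivatives of the
     zero function remain. *)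
  rewrite addn0 => -> al be al0 N; exists 0 => // x xi xiZ.
  rewrite mul0r mlist0 /= => [|j]; last exact: al0.
  pose k : 'rV[int]_n := \row_j Num.floor (xi 0 j).
  have -> : xi = latt R k.
    apply/matrixP => a j; rewrite ord1 !mxE.
    by have [//|z ->] := xiZ j; rewrite intrKfloor.
  rewrite pd_inl (_ : (fun y => _) = fun=> 0) ?pd0 ?normr0//.
  by apply/funext => y.
rewrite addnS => idn al be al0 N.
have ilt : (i < n)%N by rewrite -idn ltnS leq_addr.
pose i0 := Ordinal ilt.
pose al' q := fun j : 'I_n => if j == i0 then q else al j.
have al'q q : mlist (al' q) = nseq q i0 ++ mlist (al' 0%N).
  rewrite (@mlist_split _ i0) /al' ?eqxx => [|j ji].
    by congr (_ ++ mlist _); apply/funext => j; case: eqVneq.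
  by rewrite ifF ?al0//; apply/negbTE; rewrite -val_eqE /= ltn_eqF.
have al'p : al = al' (al i0).
  by apply/funext => j; rewrite /al'; case: eqVneq => [->|].
have [C1 C10 HC1] := IH i.+1 ltac:(by rewrite addSn) (al' 0%N) be
  ltac:(by move=> j; rewrite ltnS leq_eqVlt /al' -val_eqE /=; case: eqP => //= _ /al0) N.
(* [M] exceeds [al i0] and is so large that [M] derivatives in coordinate [i0] bring the exponent of
   the symbol bound down to at most [- N]. *)
pose M := (al i0 + Num.truncn ((N%:R + `|m| + `|delta| * (mabs be)%:R) / rho)).+1.
have [C2 HC2] := bc (al' M) be.
have sM : m - rho * (mabs (al' M))%:R + delta * (mabs be)%:R <= - N%:R.
  have MM : M%:R <= (mabs (al' M))%:R :> R.
    by rewrite ler_nat /mabs (bigD1 i0)//= {1}/al' eqxx leq_addr.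
  have : N%:R + `|m| + `|delta| * (mabs be)%:R <= rho * M%:R.
    rewrite [rho * _]mulrC -ler_pdivrMr//; apply/ltW; apply: lt_le_trans (truncnS_gt _) _.
    by rewrite ler_nat ltnS leq_addl.
  have : rho * M%:R <= rho * (mabs (al' M))%:R by rewrite ler_wpM2l// ltW.
  have : delta * (mabs be)%:R <= `|delta| * (mabs be)%:R by rewrite ler_wpM2r// ler_norm.
  have := ler_norm m; lra.
(* Points of the segment used below differ from [xi] only in coordinate [i0], and there by at most
   [M + 1]. *)
have [cJ cJ0 HcJ] := @japanese_pow_near R n M.+1%:R (- N%:R).
exists (M.+2%:R ^+ (M - al i0) * (2 ^+ M * (C1 * cJ) + `|C2| * cJ)).
  by rewrite mulr_ge0 ?exprn_ge0// addr_ge0// !mulr_ge0 ?exprn_ge0// ltW.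
move=> x xi xiZ.
pose F y := pd E (map inr (mlist (al' 0%N)) ++ map inl (mlist be)) c (x, y).
have sF : rsmooth e F by apply: rsmooth_slicexi; exact: rsmooth_pd.
have FE q y : pd E (map inr (mlist (al' q)) ++ map inl (mlist be)) c (x, y) =
    pd e (nseq q i0) F y.
  by rewrite al'q map_cat -catA pd_cat pd_inr.
(* [eta] below is [xi] with coordinate [i0] rounded down; the points [j%:R *: e i0 + eta] have one
   more integral coordinate, so the induction hypothesis applies to them. *)
pose t := xi 0 i0 - (Num.floor (xi 0 i0))%:~R.
have [t0 t1] : 0 <= t /\ t < 1.
  have /andP[h1 h2] := floor_itv (xi 0 i0).
  by rewrite intrD in h2; rewrite /t; split; lra.
pose eta := xi - t *: e i0.
have ptE s j : (s *: e i0 + eta) 0 j =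
    if j == i0 then s + (Num.floor (xi 0 i0))%:~R else xi 0 j.
  by rewrite !mxE eqxx; case: eqVneq => [->|_]; rewrite /t /= ?mulr1n ?mulr0n; ring.
have near s : 0 <= s <= M%:R ->
    japanese (s *: e i0 + eta) `^ (- N%:R) <= cJ * japanese xi `^ (- N%:R).
  move=> /andP[s0 sM']; apply: HcJ => j; rewrite ptE.
  case: eqVneq => [->|_]; last by rewrite subrr normr0.
  have -> : s + (Num.floor (xi 0 i0))%:~R - xi 0 i0 = s - t by rewrite /t; ring.
  by rewrite ler_norml -natr1; apply/andP; split; lra.
have JN0 : 0 <= japanese xi `^ (- N%:R) by exact: powR_ge0.
have xiE : t *: e i0 + eta = xi by rewrite addrC subrK.
rewrite {1}al'p FE -[X in pd _ _ _ X]xiE -mulrA mulrDl -!mulrA.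
apply: (@pd_nseq_small F i0 M _ _ eta sF).
- by rewrite mulr_ge0// mulr_ge0// ltW.
- by rewrite mulr_ge0// mulr_ge0// ltW.
- move=> j jM; apply: le_trans (HC1 _ _ _) _.
    move=> l; rewrite ptE; case: eqVneq => [_ _|li0].
      by exists (j%:Z + Num.floor (xi 0 i0)); rewrite intrD.
    rewrite ltnS leq_eqVlt => /orP[/eqP E0|/xiZ//].
    by case/eqP: li0; apply/val_inj.
  by rewrite ler_wpM2l// near// ler0n ler_nat.
- move=> s sM'; rewrite -FE; apply: le_trans (HC2 _ _) _.
  apply: (@le_trans _ _ (`|C2| * japanese (s *: e i0 + eta) `^ (- N%:R))); last first.
    by rewrite ler_wpM2l// near.
  apply: (@le_trans _ _ (`|C2| * japanese (s *: e i0 + eta) `^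
      (m - rho * (mabs (al' M))%:R + delta * (mabs be)%:R))).
    by rewrite ler_wpM2r ?powR_ge0// ler_norm.
  by rewrite ler_wpM2l// ler_powR// japanese_ge1.
- by rewrite /M -addnS leq_addr.
- by rewrite t0 (le_trans (ltW t1))// ler1n.
Qed.

End RealSymbols.

(** * Extension of toroidal symbols *)

Section Combinatorics.
Variable n : nat.

(** A list in a type independent of [N], so that sums over boxes of different sizes can be
    compared. *)
Definition box (N : nat) : seq {ffun 'I_n -> nat} :=
  [seq [ffun j => val (q j)] | q : {ffun 'I_n -> 'I_N.+1}].

Lemma mem_box N (p : {ffun 'I_n -> nat}) : (p \in box N) = [forall j, p j <= N]%N.
Proof.
apply/mapP/forallP => [[q _ ->] j|pN]; first by rewrite ffunE -ltnS ltn_ord.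
exists [ffun j => inord (p j)]; first by rewrite mem_enum.
by apply/ffunP => j; rewrite !ffunE /= inordK// ltnS.
Qed.

Lemma box_uniq N : uniq (box N).
Proof.
rewrite map_inj_uniq ?enum_uniq// => q r /ffunP qr; apply/ffunP => j.
by have := qr j; rewrite !ffunE => /val_inj.
Qed.

Lemma sum_box_sub (R : nmodType) N M (f : {ffun 'I_n -> nat} -> R) : (N <= M)%N ->
  \sum_(p <- box N) f p = \sum_(p <- box M | p \in box N) f p.
Proof.
move=> NM; rewrite -[RHS]big_filter; apply: perm_big; apply: uniq_perm.
- exact: box_uniq.
- by rewrite filter_uniq// box_uniq.
- move=> p; rewrite mem_filter; case: (boolP (p \in box N)) => //=.
  rewrite !mem_box => /forallP pN; apply/esym/forallP => j.
  exact: leq_trans (pN j) NM.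
Qed.

Definition upd (T : Type) (q : {ffun 'I_n -> T}) (i : 'I_n) (t : T) :
  {ffun 'I_n -> T} :=
  [ffun j => if j == i then t else q j].

(** Splits off the summation over the value at [i]; the value [t0] is a placeholder selecting one
    representative [r] for each choice of the other values. *)
Lemma sum_upd (R : nmodType) (T : finType) (t0 : T) (i : 'I_n)
    (f : {ffun 'I_n -> T} -> R) :
  \sum_q f q = \sum_(r : {ffun 'I_n -> T} | r i == t0) \sum_t f (upd r i t).
Proof.
rewrite (partition_big (fun q => upd q i t0)
  (fun r : {ffun 'I_n -> T} => r i == t0)) /=; last first.
  by move=> q _; rewrite ffunE eqxx.
apply: eq_bigr => r /eqP ri.
rewrite (reindex_onto (fun t => upd r i t) (fun q : {ffun 'I_n -> T} => q i)) /=.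
  apply: eq_bigl => t; rewrite ffunE eqxx eqxx andbT; apply/eqP/ffunP => j.
  by rewrite !ffunE; case: eqVneq => [->|].
move=> q /eqP <-; apply/ffunP => j; rewrite !ffunE.
by case: eqVneq => [->|].
Qed.

(* The coefficients are exchanged one coordinate at a time. *)
Lemma sum_prod_swap (R : comPzRingType) (T : finType) (t0 : T) (c v : 'I_n -> T -> R)
    (f : {ffun 'I_n -> T} -> R) :
  (forall i q, \sum_t c i t * f (upd q i t) = \sum_t v i t * f (upd q i t)) ->
  \sum_(q : {ffun 'I_n -> T}) (\prod_j c j (q j)) * f q =
  \sum_(q : {ffun 'I_n -> T}) (\prod_j v j (q j)) * f q.
Proof.
move=> cv.
(* Hybrid coefficients: the first [k] coordinates are already exchanged. *)
pose h k (i : 'I_n) := if (i < k)%N then v i else c i.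
suff key k : (k <= n)%N ->
    \sum_(q : {ffun 'I_n -> T}) (\prod_j h 0%N j (q j)) * f q =
    \sum_(q : {ffun 'I_n -> T}) (\prod_j h k j (q j)) * f q.
  have := key n (leqnn n); rewrite /h => E.
  apply: etrans E _; apply: eq_bigr => q _; congr (_ * _).
  by apply: eq_bigr => j _; rewrite ltn_ord.
elim: k => // k IH kn; rewrite IH ?(ltnW kn)//.
pose i := Ordinal kn.
rewrite (sum_upd t0 i) [RHS](sum_upd t0 i); apply: eq_bigr => r _.
have hE k' t : (\prod_j h k' j (upd r i t j)) * f (upd r i t) =
    (\prod_(j | j != i) h k' j (r j)) * (h k' i t * f (upd r i t)).
  rewrite (bigD1 i)//= ffunE eqxx -mulrA [RHS]mulrCA; congr (_ * (_ * _)).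
  by apply: eq_bigr => j ji; rewrite ffunE (negbTE ji).
under eq_bigr do rewrite hE.
under [RHS]eq_bigr do rewrite hE.
rewrite -!mulr_sumr; congr (_ * _).
  apply: eq_bigr => j ji; have jk : ((j : nat) == k) = false by exact: negbTE ji.
  by rewrite /h ltnS [(j <= k)%N]leq_eqVlt jk.
by rewrite /h ltnn ltnSn; exact: cv.
Qed.

End Combinatorics.

(** * The slowly growing truncation order, and the summed form of Pascal's rule *)

Section SlowGrowth.
Variable R : realType.

Lemma slow_growth (K : nat -> R) : exists N : R -> nat,
  (forall t, 1 <= t -> K (N t) <= (1 + `|K 0%N|) * t) /\
  (forall Q, exists T, forall t, T < t -> (Q <= N t)%N).
Proof.
exists (fun t => (\max_(i < (Num.truncn t).+1 | (K i <= t)%R) i)%N); split=> [t t1|Q].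
  have t0 : 0 <= t by exact: le_trans t1.
  set I := BIG_P.
  case: (pickP (fun i : 'I_(Num.truncn t).+1 => K i <= t)) => [i Ki|Kn].
    have [|j Kj ->] := @eq_bigmax_cond _
      (fun i : 'I_(Num.truncn t).+1 => K i <= t) (fun i => i : nat).
      by apply/card_gt0P; exists i.
    apply: le_trans Kj _; rewrite ler_peMl// lerDl//.
  rewrite big_pred0//; apply: le_trans (ler_norm _) _.
  by apply: (@le_trans _ _ (1 + `|K 0%N|)); [rewrite lerDr|rewrite ler_peMr// addr_ge0].
exists (Num.max Q%:R (K Q)) => t; rewrite gt_max => /andP[Qt KQt].
have QT : (Q < (Num.truncn t).+1)%N.
  by rewrite ltnS truncn_ge_nat ?(ltW Qt)// (le_trans _ (ltW Qt)).
by apply: (@leq_bigmax_cond _ _ _ (Ordinal QT)); exact: ltW.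
Qed.

(** If [g p] is the [p]-th difference at a lattice point, then [g p + g p.+1] is the one at the next
    point. Summing [wt_newton] moves everything to the first point and leaves one boundary term of
    order [Q + 1]. *)
Lemma wt_newton_sum (a Q : nat) (u : R) (g : nat -> R) : 0 <= u -> u <= 1 ->
  \sum_(p < Q.+1) (derive1n a (wt p) u * g p + derive1n a (wt p) (u - 1) * (g p + g p.+1)) =
  \sum_(p < Q.+1) (newton R p)^`(a).[u] * g p + derive1n a (wt Q) (u - 1) * g Q.+1.
Proof.
move=> u0 u1; elim: Q => [|Q IH].
  rewrite !big_ord_recl !big_ord0 /= -(@wt_newton _ 0 a u u0 u1); ring.
rewrite big_ord_recr IH [in RHS]big_ord_recr /= -(@wt_newton _ Q.+1 a u u0 u1); ring.
Qed.

End SlowGrowth.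

(** * Derivatives and continuity of finite sums and of products over coordinates *)

Section DeriveTools.
Variable R : realType.

Lemma is_derive_from_line (V : normedModType R) (F : V -> R) (z v : V) (d : R) :
  is_derive (0 : R) 1 (fun t => F (t *: v + z)) d -> is_derive z v F d.
Proof.
have E : (fun h : R => h^-1 *:
    (((fun t => F (t *: v + z)) \o shift 0) (h *: (1 : R)) - F (0 *: v + z))) =
  (fun h : R => h^-1 *: ((F \o shift z) (h *: v) - F z)).
  by apply/funext => h /=; rewrite addr0 scale0r add0r [h%:A]mulr1.
by move=> [d1 d2]; apply: DeriveDef; rewrite /derivable /derive -E.
Qed.

Lemma is_derive_sum_seq (V : normedModType R) (I : Type) (r : seq I)
    (F : I -> V -> R) (d : I -> R) (z v : V) :
  (forall i, is_derive z v (F i) (d i)) ->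
  is_derive z v (fun y => \sum_(i <- r) F i y) (\sum_(i <- r) d i).
Proof.
move=> Fd; elim: r => [|i r IH].
  rewrite big_nil (_ : (fun _ => _) = cst 0); first exact: is_derive_cst.
  by apply/funext => y; rewrite big_nil.
rewrite big_cons (_ : (fun _ => _) = F i \+ (fun y => \sum_(j <- r) F j y)).
  exact: is_deriveD.
by apply/funext => y; rewrite big_cons.
Qed.

Lemma continuous_sum_seq (T : topologicalType) (I : Type) (r : seq I)
    (F : I -> T -> R) (z : T) :
  (forall i, {for z, continuous (F i)}) ->
  {for z, continuous (fun y => \sum_(i <- r) F i y)}.
Proof.
move=> cF; elim: r => [|i r IH].
  rewrite (_ : (fun _ => _) = cst 0); first exact: cst_continuous.
  by apply/funext => y; rewrite big_nil.
rewrite (_ : (fun _ => _) = F i \+ (fun y => \sum_(j <- r) F j y)).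
  by apply: continuousD; [exact: cF|exact: IH].
by apply/funext => y; rewrite big_cons.
Qed.

Lemma continuous_prod_seq (T : topologicalType) (I : Type) (r : seq I)
    (F : I -> T -> R) (z : T) :
  (forall i, {for z, continuous (F i)}) ->
  {for z, continuous (fun y => \prod_(i <- r) F i y)}.
Proof.
move=> cF; elim: r => [|i r IH].
  rewrite (_ : (fun _ => _) = cst 1); first exact: cst_continuous.
  by apply/funext => y; rewrite big_nil.
rewrite (_ : (fun _ => _) = F i \* (fun y => \prod_(j <- r) F j y)).
  by apply: continuousM; [exact: cF|exact: IH].
by apply/funext => y; rewrite big_cons.
Qed.

Lemma is_derive_prod_coord n (f f' : 'I_n -> R -> R) (xi : 'rV[R]_n) (j : 'I_n) :
  (forall t : R, is_derive t 1 (f j) (f' j t)) ->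
  is_derive xi (unitv R j) (fun y => \prod_i f i (y 0 i))
    (f' j (xi 0 j) * \prod_(i | i != j) f i (xi 0 i)).
Proof.
move=> fj; apply: is_derive_from_line.
pose P := \prod_(i | i != j) f i (xi 0 i).
rewrite (_ : (fun t => _) = (fun t => f j (t + xi 0 j) * P)); last first.
  apply/funext => t; rewrite (bigD1 j)//= !mxE !eqxx /= mulr1; congr (_ * _).
  by apply: eq_bigr => i ij; rewrite !mxE (negbTE ij) andbF mulr0 add0r.
have d1 : is_derive (0 : R) 1 (f j \o (fun t => t + xi 0 j)) (f' j (0 + xi 0 j) * 1).
  apply: is_derive1_comp; exact: is_derive_shift.
have d2 := is_deriveM d1 (is_derive_cst P (0 : R) (1 : R)).
apply: (is_derive_eq d2).
by rewrite scaler0 add0r /GRing.scale/= mulr1 add0r mulrC.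
Qed.

End DeriveTools.

(** * The glued extension: smoothness, derivatives and interpolation on the lattice *)

Section Extension.
Variables (R : realType) (n : nat).
Local Notation V := 'rV[R]_n.
Local Notation Z := 'rV[int]_n.
Local Notation e := (@unitv R n).
Local Notation E := (@unitxxi R n).
Variables (u : V -> Z -> R) (order : Z -> nat).
Variable (u_smooth : forall k, rsmooth e (u^~ k)).

(* [s] and [a] record the [x]- and [xi]-derivatives taken of the terms; all
   derivatives of [ext [::] (fun=> 0)] are of the form [ext s a]. *)
Definition dcoef (s : seq 'I_n) (p : 'I_n -> nat) (x : V) (k : Z) : R :=
  foldr (@rdiff R n) (fun l => pd e s (u^~ l) x) (mlist p) k.

Definition weight (a p : 'I_n -> nat) (k : Z) (xi : V) : R :=
  \prod_j derive1n (a j) (@wt R (p j)) (xi 0 j - (k 0 j)%:~R).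

Definition taylor (N : nat) s a (k : Z) (z : V * V) : R :=
  \sum_(p <- box n N) dcoef s p z.1 k * weight a p k z.2.

(* A locally finite sum, as [wt] is supported in [-2/3, 2/3]. *)
Definition ext s a (z : V * V) : R :=
  \sum_(k \in [set: Z]) taylor (order k) s a k z.

Lemma dcoef_derive s p k x (j : 'I_n) :
  is_derive x (e j) ((dcoef s p)^~ k) (dcoef (j :: s) p x k).
Proof.
rewrite /dcoef; elim: (mlist p) k => [|i r IH] k /=.
  by apply: DeriveDef => //; exact: (u_smooth k s).2.
by apply: is_deriveB; exact: IH.
Qed.

Lemma dcoef_continuous s p k : continuous ((dcoef s p)^~ k).
Proof.
rewrite /dcoef; elim: (mlist p) k => [|i r IH] k /=; first exact: (u_smooth k s).1.
by move=> x; apply: continuousB; exact: IH.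
Qed.

Lemma weight_derive a p k xi (j : 'I_n) :
  is_derive xi (e j) (weight a p k) (weight (fun i => (a i + (i == j))%N) p k xi).
Proof.
pose f i t := derive1n (a i) (@wt R (p i)) (t - (k 0 i)%:~R).
pose f' i t := derive1n (a i).+1 (@wt R (p i)) (t - (k 0 i)%:~R).
have ff' (t : R) : is_derive t 1 (f j) (f' j t).
  have sw := @smooth1_shift _ _ (- (k 0 j)%:~R) (@wt_smooth R (p j)).
  have := @derivable_is_derive1 R _ t (sw (a j) t).
  by rewrite -derive1nS !derive1n_shift.
have /is_derive_eq := @is_derive_prod_coord R n f f' xi j ff'; apply.
rewrite [RHS](bigD1 j)//= eqxx addn1; congr (_ * _).
by apply: eq_bigr => i /negbTE ->; rewrite addn0.
Qed.

Lemma weight_continuous a p k : continuous (weight a p k).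
Proof.
move=> xi; apply: continuous_prod_seq => j.
apply: (@continuous_comp _ _ _ (fun y : V => y 0 j - (k 0 j)%:~R)).
  by apply: continuousB; [exact: coord_continuous|exact: cst_continuous].
exact: smooth1_continuous (@wt_smooth R (p j)) _.
Qed.

Lemma weight_supp a p (k : Z) (xi : V) j :
  2 / 3 < `|xi 0 j - (k 0 j)%:~R| -> weight a p k xi = 0.
Proof. by move=> h; rewrite /weight (bigD1 j)//= wt_supp// mul0r. Qed.

Lemma taylor_supp N s a (k : Z) (z : V * V) j :
  2 / 3 < `|z.2 0 j - (k 0 j)%:~R| -> taylor N s a k z = 0.
Proof. by move=> h; rewrite /taylor big1// => p _; rewrite (weight_supp _ _ h) mulr0. Qed.

(** The vertices of the unit cube whose lowest vertex is [l]. *)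
Definition corner (l : Z) (c : {ffun 'I_n -> 'I_2}) : Z :=
  \row_j (l 0 j + (c j : nat)%:Z).

Lemma corner_inj l : injective (corner l).
Proof.
move=> c d /matrixP cd; apply/ffunP => j; have := cd 0 j; rewrite !mxE.
by move=> /addrI [] /val_inj.
Qed.

Definition cell s a (l : Z) (z : V * V) : R :=
  \sum_c taylor (order (corner l c)) s a (corner l c) z.

(** A lattice point that is not a corner has a coordinate at most [l_j - 1] or at least [l_j + 2],
    hence at distance more than [2/3] from [z.2], outside the support of the weight. *)
Lemma ext_local s a (l : Z) (z : V * V) :
  (forall j, - 3^-1 < z.2 0 j - (l 0 j)%:~R < 4 / 3) ->
  ext s a z = cell s a l z.
Proof.
move=> zl; rewrite /ext /cell.
have U : uniq [seq corner l c | c : {ffun 'I_n -> 'I_2}].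
  by rewrite map_inj_uniq ?enum_uniq//; exact: corner_inj.
have := @bigfs R 0 +%R Z _ predT (fun k => taylor (order k) s a k z) U.
rewrite big_map big_enum /= => ->; last first.
  move=> k _ kl.
  have [j kj] : exists j, ~~ ((k 0 j == l 0 j) || (k 0 j == l 0 j + 1)).
    apply/existsP; rewrite -negb_forall; apply: contra kl => /forallP kl.
    apply/mapP; exists [ffun j => inord (k 0 j != l 0 j)]; first by rewrite mem_enum.
    apply/matrixP => i j; rewrite ord1 !mxE ffunE inordK; last by case: (_ != _).
    by have /orP[/eqP->|/eqP->] := kl j; rewrite ?eqxx ?addr0// -subr_eq0 addrAC subrr add0r.
  have /andP[z1 z2] := zl j; apply: (@taylor_supp _ _ _ _ _ j).
  rewrite lter_normr; apply/orP.
  have [kl'|kl'] := ltP (k 0 j) (l 0 j).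
    left; have : k 0 j <= l 0 j - 1 by rewrite lerBrDr -ltzD1 ltrD2r.
    by rewrite -(ler_int R) intrB => ?; lra.
  right; have : l 0 j + 2 <= k 0 j.
    move: kj; rewrite negb_or => /andP[k1 k2].
    have : l 0 j + 1 <= k 0 j by rewrite lezD1 lt_neqAle eq_sym k1.
    by rewrite le_eqVlt eq_sym (negbTE k2) /= -lezD1 -addrA.
  by rewrite -(ler_int R) intrD => ?; lra.
apply: eq_fsbigl; rewrite eqEsubset; split=> //.
Qed.

Definition floorv (xi : V) : Z := \row_j Num.floor (xi 0 j).

Lemma floorv_itv (xi : V) j : 0 <= xi 0 j - (floorv xi 0 j)%:~R < 1.
Proof.
rewrite mxE; have /andP[h1 h2] := floor_itv (xi 0 j).
by rewrite intrD in h2; apply/andP; split; lra.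
Qed.

Lemma floorv_cell (xi : V) j : - 3^-1 < xi 0 j - (floorv xi 0 j)%:~R < 4 / 3.
Proof. by have /andP[h1 h2] := floorv_itv xi j; apply/andP; split; lra. Qed.

(** The condition of [ext_local] is open and holds for the cell of [z0], so continuity and
    [xi]-derivatives of [ext] are those of one finite sum. *)
Lemma ext_near s a (z0 : V * V) :
  \forall z \near z0, ext s a z = cell s a (floorv z0.2) z.
Proof.
suff : nbhs z0 [set z : V * V | forall j, - 3^-1 < z.2 0 j - (floorv z0.2 0 j)%:~R < 4 / 3].
  by apply: filterS => z; exact: ext_local.
apply: (@filter_forall _ _ (fun j => [set z : V * V |
  - 3^-1 < z.2 0 j - (floorv z0.2 0 j)%:~R < 4 / 3]) (nbhs z0)) => j.
have cj : {for z0, continuous (fun z : V * V => z.2 0 j - (floorv z0.2 0 j)%:~R)}.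
  apply: continuousB; last exact: cst_continuous.
  apply: (@continuous_comp _ _ _ (fun z : V * V => z.2) (fun y : V => y 0 j)).
    exact: cvg_snd.
  exact: coord_continuous.
have /andP[h1 h2] := floorv_cell z0.2 j.
near=> z; apply/andP; split; near: z.
  by apply: (cvgr_gt _ cj).
by apply: (cvgr_lt _ cj).
Unshelve. all: by end_near. Qed.

Lemma taylor_inl N s a k x xi j :
  is_derive x (e j) (fun y => taylor N s a k (y, xi)) (taylor N (j :: s) a k (x, xi)).
Proof.
apply: is_derive_sum_seq => p /=.
have d := is_deriveM (dcoef_derive s p k x j) (is_derive_cst (weight a p k xi) x (e j)).
apply: (is_derive_eq d).
by rewrite scaler0 add0r /GRing.scale/= mulrC.
Qed.

Lemma taylor_inr N s a k x xi j :
  is_derive xi (e j) (fun y => taylor N s a k (x, y))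
    (taylor N s (fun i => (a i + (i == j))%N) k (x, xi)).
Proof.
apply: is_derive_sum_seq => p /=.
have d := is_deriveM (is_derive_cst (dcoef s p x k) xi (e j)) (weight_derive a p k xi j).
apply: (is_derive_eq d).
by rewrite scaler0 addr0.
Qed.

Lemma taylor_continuous N s a k : continuous (taylor N s a k).
Proof.
move=> z; apply: continuous_sum_seq => p; apply: continuousM.
  apply: (@continuous_comp _ _ _ (fun z : V * V => z.1) ((dcoef s p)^~ k)).
    exact: cvg_fst.
  exact: dcoef_continuous.
apply: (@continuous_comp _ _ _ (fun z : V * V => z.2) (weight a p k)).
  exact: cvg_snd.
exact: weight_continuous.
Qed.

Lemma ext_continuous s a : continuous (ext s a).
Proof.
move=> z0.
pose F := cell s a (floorv z0.2).
have En : {near z0, F =1 ext s a}.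
  by apply: filterS (ext_near s a z0) => z ->.
have : {for z0, continuous F} by apply: continuous_sum_seq => c; exact: taylor_continuous.
rewrite /continuous_at (nbhs_singleton (ext_near s a z0)) -/(F z0).
by move=> cF; apply: (cvg_trans _ (cF : F z @[z --> z0] --> F z0)); exact: near_eq_cvg.
Qed.

Lemma ext_inl s a z j : is_derive z (E (inl j)) (ext s a) (ext (j :: s) a z).
Proof.
case: z => x xi.
(* With [xi] fixed, the same cell serves for every [x]. *)
have Ex y s' : ext s' a (y, xi) = cell s' a (floorv xi) (y, xi).
  by apply: ext_local => i; exact: floorv_cell.
have [d1 d2] : is_derive x (e j) (fun y => ext s a (y, xi)) (ext (j :: s) a (x, xi)).
  rewrite Ex (_ : (fun y => _) = (fun y => cell s a (floorv xi) (y, xi))).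
    by apply: is_derive_sum_seq => c; exact: taylor_inl.
  by apply/funext => y; rewrite Ex.
by apply: DeriveDef; [rewrite derivable_inl|rewrite derive_inl].
Qed.

Lemma ext_inr s a z j :
  is_derive z (E (inr j)) (ext s a) (ext s (fun i => (a i + (i == j))%N) z).
Proof.
pose F a := cell s a (floorv z.2).
rewrite (nbhs_singleton (ext_near _ _ z)) -/(F _ z).
apply: (@near_eq_is_derive _ _ _ (F a)).
  by apply: filterS (ext_near s a z) => z' ->.
case: z @F => x xi F.
have [d1 d2] : is_derive xi (e j) (fun y => F a (x, y))
    (F (fun i => (a i + (i == j))%N) (x, xi)).
  by apply: is_derive_sum_seq => c; exact: taylor_inr.
by apply: DeriveDef; [rewrite derivable_inr|rewrite derive_inr].
Qed.

Lemma pd_ext_inl t s a : pd E (map inl t) (ext s a) = ext (t ++ s) a.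
Proof.
elim: t => //= j t ->; apply/funext => z.
by have [_] := ext_inl (t ++ s) a z j.
Qed.

Lemma pd_ext_inr t s a :
  pd E (map inr t) (ext s a) = ext s (fun i => (a i + count_mem i t)%N).
Proof.
elim: t => [|j t IH] /=; first by congr ext; apply/funext => i; rewrite addn0.
rewrite IH; apply/funext => z.
have [_ ->] := ext_inr s (fun i => (a i + count_mem i t)%N) z j.
by congr (ext _ _ z); apply/funext => i; rewrite /= eq_sym -addnA (addnC (count_mem _ _)).
Qed.

Lemma ext_smooth s a : rsmooth E (ext s a).
Proof.
move=> t; have [s' [a' ->]] : exists s' a', pd E t (ext s a) = ext s' a'.
  elim: t => [|[j|j] t [s' [a' IH]]]; first by exists s, a.
    exists (j :: s'), a'; apply/funext => z /=; rewrite IH.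
    by have [_] := ext_inl s' a' z j.
  exists s', (fun i => (a' i + (i == j))%N); apply/funext => z /=; rewrite IH.
  by have [_] := ext_inr s' a' z j.
split; first exact: ext_continuous.
by move=> [j|j] z; [have [] := ext_inl s' a' z j|have [] := ext_inr s' a' z j].
Qed.

Lemma pd_ext alpha beta :
  pd E (map inr (mlist alpha) ++ map inl (mlist beta)) (ext [::] (fun=> 0%N)) =
  ext (mlist beta) alpha.
Proof.
rewrite pd_cat pd_ext_inl cats0 pd_ext_inr; congr ext.
by apply/funext => i; rewrite add0n count_mlist.
Qed.

(** By [wt_int] only the corner [k] and the multi-index [p = 0] contribute, and the difference of
    order zero is [u] itself. *)
Lemma ext_interp x k : ext [::] (fun=> 0%N) (x, latt R k) = u x k.
Proof.
pose c0 : {ffun 'I_n -> 'I_2} := [ffun=> ord0].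
have ck : corner k c0 = k by apply/matrixP => i j; rewrite ord1 !mxE ffunE addr0.
pose p0 : {ffun 'I_n -> nat} := [ffun=> 0%N].
have W (p : {ffun 'I_n -> nat}) c :
    weight (fun=> 0%N) p (corner k c) (latt R k) = ((c == c0) && (p == p0))%:R.
  rewrite /weight /=.
  have [cE|cn] /= := eqVneq c c0; last first.
    have [j cj] : exists j, c j != ord0.
      apply/existsP; rewrite -negb_forall; apply: contra cn => /forallP h.
      by apply/eqP/ffunP => j; rewrite ffunE; exact/eqP.
    rewrite (bigD1 j)//= !mxE -intrB wt_int opprD addrA subrr sub0r oppr_eq0.
    have -> : ((c j : nat)%:Z == 0) = false by exact: negbTE cj.
    by rewrite mul0r.
  have [pE|pn] := eqVneq p p0.
    rewrite big1// => j _; rewrite !mxE -intrB wt_int cE pE !ffunE.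
    by rewrite addr0 subrr.
  have [j pj] : exists j, p j != 0%N.
    apply/existsP; rewrite -negb_forall; apply: contra pn => /forallP h.
    by apply/eqP/ffunP => j; rewrite ffunE; exact/eqP.
  by rewrite (bigD1 j)//= !mxE -intrB wt_int (negbTE pj) andbF mul0r.
rewrite (@ext_local _ _ k) => [|j]; last first.
  by rewrite /= mxE subrr; apply/andP; split; lra.
rewrite /cell (bigD1 c0)//= [X in _ + X]big1 => [|c cc0]; last first.
  by rewrite /taylor big1// => p _; rewrite /= W (negbTE cc0) mulr0.
rewrite addr0 /taylor ck (bigD1_seq p0) ?box_uniq//=; last first.
  by rewrite mem_box; apply/forallP => j; rewrite ffunE.
have Wk (p : {ffun 'I_n -> nat}) : weight (fun=> 0%N) p k (latt R k) = (p == p0)%:R.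
  by rewrite -{1}ck W eqxx.
rewrite (Wk p0) eqxx mulr1 big1 ?addr0 => [|p pp0]; last first.
  by rewrite Wk (negbTE pp0) mulr0.
rewrite /dcoef (_ : mlist _ = [::])//=.
by apply: mlist0 => j; rewrite ffunE.
Qed.

End Extension.

(** * Differences commute *)

Section CommutingDifferences.
Variables (R : realType) (n : nat).
Local Notation Z := 'rV[int]_n.
Implicit Types (f : Z -> R) (s : seq 'I_n).

Lemma rdiff_foldr j f s :
  foldr (@rdiff R n) (rdiff j f) s = rdiff j (foldr (@rdiff R n) f s).
Proof.
elim: s => //= i s ->; apply/funext => k; rewrite /rdiff (addrAC k); ring.
Qed.

Lemma foldr_rdiff_perm f s1 s2 : perm_eq s1 s2 ->
  foldr (@rdiff R n) f s1 = foldr (@rdiff R n) f s2.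
Proof.
elim: s1 s2 => [|j s1 IH] s2; first by rewrite perm_sym => /perm_nilP ->.
move=> js; have : j \in s2 by rewrite -(perm_mem js) mem_head.
move=> /splitPr E; case: E js => p1 p2 js.
have /IH /= -> : perm_eq s1 (p1 ++ p2).
  by rewrite -(perm_cons j) (perm_trans js)// perm_catC /= perm_cons perm_catC.
by rewrite !foldr_cat /= rdiff_foldr.
Qed.

(** Brings the differences in coordinate [i] outermost, so that the one-variable identity can be
    applied there. *)
Lemma foldr_mlist_iter f (p p' : 'I_n -> nat) i : p' i = 0%N ->
  (forall j, j != i -> p' j = p j) ->
  foldr (@rdiff R n) f (mlist p) =
  iter (p i) (rdiff i) (foldr (@rdiff R n) f (mlist p')).
Proof.
move=> p'i p'E; have -> : iter (p i) (rdiff i) (foldr (@rdiff R n) f (mlist p')) =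
    foldr (@rdiff R n) f (nseq (p i) i ++ mlist p').
  by rewrite foldr_cat; elim: (p i) => //= q ->.
apply: foldr_rdiff_perm; apply/allP => j _ /=.
rewrite count_cat count_nseq !count_mlist /=; apply/eqP.
have [<-|ij] := eqVneq i j; first by rewrite p'i mul1n addn0.
by rewrite p'E 1?eq_sym.
Qed.

End CommutingDifferences.

(** * Symbol estimates for the extension *)

Section Estimate.
Variables (R : realType) (n : nat) (m rho delta : R).
Local Notation V := 'rV[R]_n.
Local Notation Z := 'rV[int]_n.
Local Notation e := (@unitv R n).
Local Notation E := (@unitxxi R n).
Local Notation jap k := (japanese (latt R k)).
Variables (u : V -> Z -> R) (rho_gt0 : 0 < rho) (u_bound : tbound m rho delta u).
Implicit Types (a b p : 'I_n -> nat).

Definition ccst p b : R := `|sval (cid (u_bound p b))|.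

Lemma dcoef_le p b x k : `|dcoef u (mlist b) p x k| <=
  ccst p b * jap k `^ (m - rho * (mabs p)%:R + delta * (mabs b)%:R).
Proof.
rewrite /ccst; case: cid => C /= HC; apply: le_trans (HC x k) _.
by rewrite ler_wpM2r ?powR_ge0// ler_norm.
Qed.

Definition wcst a p : R := \prod_j sval (cid (@wt_bounded R (p j) (a j))).

Lemma weight_le a p (k : Z) (xi : V) : `|weight a p k xi| <= wcst a p.
Proof.
rewrite /weight normr_prod; apply: ler_prod => j _; rewrite normr_ge0 /=.
by case: cid => C /= HC.
Qed.

Lemma wcst_ge0 a p : 0 <= wcst a p.
Proof. exact: le_trans (normr_ge0 _) (weight_le a p 0 0). Qed.

Definition tcst a b p : R := ccst p b * wcst a p.

Lemma tcst_ge0 a b p : 0 <= tcst a b p.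
Proof. by apply: mulr_ge0; [exact: normr_ge0|exact: wcst_ge0]. Qed.

Lemma term_le a b p (x xi : V) k : `|dcoef u (mlist b) p x k * weight a p k xi| <=
  tcst a b p * jap k `^ (m - rho * (mabs p)%:R + delta * (mabs b)%:R).
Proof.
rewrite normrM /tcst mulrAC; apply: ler_pM => //; first exact: dcoef_le.
exact: weight_le.
Qed.

(* A bound for all constants met up to order [N]; [order k] is chosen so that
   [total_cst (order k)] is at most a multiple of [<k>^rho]. *)
Definition total_cst (N : nat) : R :=
  \sum_(p <- box n N) \sum_(a <- box n N) \sum_(b <- box n N) tcst a b p.

Lemma finfunE a : ([ffun j => a j] : {ffun 'I_n -> nat}) = a :> ('I_n -> nat).
Proof. by apply/funext => j; rewrite ffunE. Qed.

Lemma sum_tcst_le a b N : (forall j, (a j <= N)%N) -> (forall j, (b j <= N)%N) ->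
  \sum_(p <- box n N) tcst a b p <= total_cst N.
Proof.
move=> aN bN; apply: ler_sum => p _.
rewrite (bigD1_seq [ffun j => a j]) ?box_uniq//=; last first.
  by rewrite mem_box; apply/forallP => j; rewrite ffunE.
rewrite (bigD1_seq [ffun j => b j]) ?box_uniq//=; last first.
  by rewrite mem_box; apply/forallP => j; rewrite ffunE.
rewrite !finfunE -addrA lerDl addr_ge0//; apply: sumr_ge0 => *; first exact: tcst_ge0.
by apply: sumr_ge0 => *; exact: tcst_ge0.
Qed.

Lemma jap_pow_ge1 (k : Z) : 1 <= jap k `^ rho.
Proof. by rewrite -(powRr0 (jap k)) ler_powR ?japanese_ge1// ltW. Qed.

Lemma order_exists : exists order : Z -> nat,
  (forall k, total_cst (order k) <= (1 + `|total_cst 0|) * jap k `^ rho) /\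
  (forall Q, exists2 T : R, 0 <= T & forall k, (order k < Q)%N -> jap k `^ rho <= T).
Proof.
have [N [N1 N2]] := slow_growth total_cst.
exists (fun k => N (jap k `^ rho)); split=> [k|Q]; first exact/N1/jap_pow_ge1.
have [T HT] := N2 Q; exists `|T| => // k; rewrite ltnNge => kQ.
by rewrite leNgt; apply: contra kQ => kT; apply/HT/(le_lt_trans (ler_norm _) kT).
Qed.

Lemma mabs_ge (a : 'I_n -> nat) j : (a j <= mabs a)%N.
Proof. by rewrite /mabs (bigD1 j)//= leq_addr. Qed.

Variable order : Z -> nat.
Variable order_slow : forall k, total_cst (order k) <= (1 + `|total_cst 0|) * jap k `^ rho.
Variable order_unbounded :
  forall Q, exists2 T : R, 0 <= T & forall k, (order k < Q)%N -> jap k `^ rho <= T.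

(** If [order k >= Q], the extra terms have order above [|a|] and gain a factor [<k>^(-rho)], which
    pays for their constants. Otherwise [<k>^rho] is bounded by [T] and the loss is a constant. *)
Lemma taylor_order_le a b Q : (mabs a < Q)%N -> (forall j, (b j <= Q)%N) ->
  exists2 C : R, 0 <= C & forall k z,
    `|taylor u (order k) (mlist b) a k z - taylor u Q (mlist b) a k z| <=
    C * jap k `^ (m - rho * (mabs a)%:R + delta * (mabs b)%:R).
Proof.
move=> aQ bQ; set s := _ + _.
have [T T0 HT] := order_unbounded Q.
have S0 : 0 <= \sum_(p <- box n Q) tcst a b p by apply: sumr_ge0 => *; exact: tcst_ge0.
exists (Num.max (1 + `|total_cst 0|) ((\sum_(p <- box n Q) tcst a b p) * T ^+ mabs a)).
  by rewrite le_max addr_ge0.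
move=> k [x xi].
have J1 : 1 <= jap k by exact: japanese_ge1.
have J0 : 0 < jap k by exact: japanese_gt0.
have Js : 0 <= jap k `^ s by exact: powR_ge0.
have tail N M : (N <= M)%N ->
    `|taylor u M (mlist b) a k (x, xi) - taylor u N (mlist b) a k (x, xi)| <=
    \sum_(p <- box n M | p \notin box n N)
      tcst a b p * jap k `^ (m - rho * (mabs p)%:R + delta * (mabs b)%:R).
  move=> NM; rewrite /taylor (sum_box_sub _ NM).
  rewrite [X in X - _](bigID (fun p : {ffun 'I_n -> nat} => p \in box n N)) /=.
  rewrite addrAC subrr add0r; apply: le_trans (ler_norm_sum _ _ _) _.
  by apply: ler_sum => p _; exact: term_le.
have [Qk|kQ] := leqP Q (order k).
  apply: le_trans (tail _ _ Qk) _.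
  apply: (@le_trans _ _ ((1 + `|total_cst 0|) * jap k `^ s)); last first.
    by rewrite ler_wpM2r// le_max lexx.
  (* The spare power [<k>^rho] is spent on [total_cst (order k)] through [order_slow]. *)
  apply: (@le_trans _ _ (\sum_(p <- box n (order k)) tcst a b p * jap k `^ (s - rho))).
    rewrite [leRHS](bigID (fun p : {ffun 'I_n -> nat} => p \notin box n Q)) /= ler_wpDr//.
      by apply: sumr_ge0 => *; rewrite mulr_ge0 ?powR_ge0 ?tcst_ge0.
    apply: ler_sum => p; rewrite mem_box negb_forall => /existsP[j]; rewrite -ltnNge => pj.
    rewrite ler_wpM2l ?tcst_ge0// ler_powR// /s.
    have ap : (mabs a)%:R + 1 <= (mabs p)%:R :> R.
      by rewrite natr1 ler_nat (leq_trans aQ)// (leq_trans (ltnW pj))// mabs_ge.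
    have := ler_wpM2l (ltW rho_gt0) ap; lra.
  rewrite -mulr_suml.
  have -> : jap k `^ s = jap k `^ rho * jap k `^ (s - rho).
    by rewrite -powRD ?(gt_eqF J0) ?implybT// addrCA subrr addr0.
  rewrite mulrA ler_wpM2r ?powR_ge0//; apply: le_trans (order_slow k).
  apply: sum_tcst_le => j.
    by rewrite (leq_trans (mabs_ge a j))// (leq_trans (ltnW aQ)).
  exact: leq_trans (bQ j) Qk.
rewrite distrC; apply: le_trans (tail _ _ (ltnW kQ)) _.
apply: (@le_trans _ _
  ((\sum_(p <- box n Q) tcst a b p) * T ^+ mabs a * jap k `^ s)); last first.
  by rewrite ler_wpM2r// le_max lexx orbT.
apply: (@le_trans _ _
  (\sum_(p <- box n Q) tcst a b p * jap k `^ (m + delta * (mabs b)%:R))).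
  rewrite [leRHS](bigID (fun p : {ffun 'I_n -> nat} => p \notin box n (order k))) /=.
  rewrite ler_wpDr//.
    by apply: sumr_ge0 => *; rewrite mulr_ge0 ?powR_ge0 ?tcst_ge0.
  apply: ler_sum => p _; rewrite ler_wpM2l ?tcst_ge0// ler_powR//.
  have : 0 <= rho * (mabs p)%:R by rewrite mulr_ge0// ltW.
  lra.
rewrite -mulr_suml -mulrA ler_wpM2l//.
(* The missing decay of order [rho |a|] is replaced by the bounded factor [T ^+ mabs a]. *)
have -> : jap k `^ (m + delta * (mabs b)%:R) = (jap k `^ rho) ^+ mabs a * jap k `^ s.
  rewrite -powR_mulrn ?powR_ge0// -powRrM -powRD ?(gt_eqF J0) ?implybT//.
  by congr (_ `^ _); rewrite /s; ring.
by rewrite ler_wpM2r// lerXn2r ?nnegrE ?powR_ge0// HT.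
Qed.

Lemma newton_bounded (p q : nat) : exists C : R, forall t, 0 <= t -> t <= 1 ->
  `|(newton R p)^`(q).[t]| <= C.
Proof.
exists (\sum_(i < size (newton R p)^`(q)) `|(newton R p)^`(q)`_i|) => t t0 t1.
rewrite horner_coef; apply: le_trans (ler_norm_sum _ _ _) _.
apply: ler_sum => i _; rewrite normrM normrX (ger0_norm t0).
by rewrite ler_piMr// exprn_ile1.
Qed.

Section LowOrder.
Variables (a b : 'I_n -> nat) (Q : nat).
Variable aQ : (mabs a < Q)%N.
Local Notation T := ('I_2 * 'I_Q.+2)%type.
Implicit Types (q : {ffun 'I_n -> T}) (l : Z) (x y : V).

(* In the cell of [l] the glued Newton polynomials have the coefficients
   [cell_coef] on the differences at all corners; by Pascal's rule the
   coefficients [corner_coef], carried by the corner [l] alone, give the same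
   sum. *)
Definition cell_coef y (i : 'I_n) (t : T) : R :=
  if (t.2 <= Q)%N then derive1n (a i) (wt (t.2 : nat)) (y 0 i - (t.1 : nat)%:R) else 0.

Definition corner_coef y (i : 'I_n) (t : T) : R :=
  if t.1 == ord0 then
    if (t.2 <= Q)%N then (newton R t.2)^`(a i).[y 0 i]
    else derive1n (a i) (wt Q) (y 0 i - 1)
  else 0.

(** Each [q j] pairs the corner bit and the order of the difference in coordinate [j]; orders go up
    to [Q + 1] because of the boundary term of [wt_newton_sum]. *)
Definition cell_diff x l q : R :=
  dcoef u (mlist b) (fun j => (q j).2 : nat) x (\row_j (l 0 j + ((q j).1 : nat)%:Z)).

(** In a single coordinate the exchange is [wt_newton_sum]; [sum_prod_swap] carries it through all
    coordinates. *)
Lemma cell_swap x l y : (forall j, 0 <= y 0 j <= 1) ->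
  \sum_(q : {ffun 'I_n -> T}) (\prod_j cell_coef y j (q j)) * cell_diff x l q =
  \sum_(q : {ffun 'I_n -> T}) (\prod_j corner_coef y j (q j)) * cell_diff x l q.
Proof.
move=> y01; apply: (sum_prod_swap (ord0, ord0)) => i q.
pose p' j := if j == i then 0%N else (q j).2 : nat.
pose k0 : Z := \row_j (l 0 j + (if j == i then 0%N else (q j).1 : nat)%:Z).
pose G := foldr (@rdiff R n) (fun l' => pd e (mlist b) (u^~ l') x) (mlist p').
pose g (p : nat) := iter p (rdiff i) G k0.
have F0 (p : 'I_Q.+2) : cell_diff x l (upd q i (ord0, p)) = g p.
  rewrite /cell_diff /dcoef (@foldr_mlist_iter _ _ _ _ p' i); last 2 first.
  - by rewrite /p' eqxx.
  - by move=> j ji; rewrite /p' (negbTE ji) ffunE (negbTE ji).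
  rewrite ffunE eqxx /= /g; congr (iter _ _ _ _).
  by apply/matrixP => r j; rewrite !mxE ffunE; case: eqVneq.
(* A value at the neighbouring corner is the value at the lower one plus one further difference. *)
have F1 (p : 'I_Q.+2) : cell_diff x l (upd q i (lift ord0 ord0, p)) = g p + g p.+1.
  rewrite /cell_diff /dcoef (@foldr_mlist_iter _ _ _ _ p' i); last 2 first.
  - by rewrite /p' eqxx.
  - by move=> j ji; rewrite /p' (negbTE ji) ffunE (negbTE ji).
  rewrite ffunE eqxx /= /g /= /rdiff addrC subrK -/(rdiff _); congr (iter _ _ _ _).
  apply/matrixP => r j; rewrite !mxE ffunE (ord1 r) (_ : (0 == 0 :> 'I_1) = true)//=.
  by case: (j == i); rewrite /= addr0.
have pairE (h : T -> R) : \sum_t h t =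
    \sum_(r : 'I_Q.+2) h (ord0, r) + \sum_(r : 'I_Q.+2) h (lift ord0 ord0, r).
  transitivity (\sum_(d : 'I_2) \sum_(r : 'I_Q.+2) h (d, r)).
    by rewrite (pair_bigA _ (fun d r => h (d, r))); apply: eq_bigr => -[].
  by rewrite (big_ord_recl 1) big_ord1.
rewrite !pairE.
have /andP[y0 y1] := y01 i.
under eq_bigr do rewrite F0 /cell_coef /= subr0.
under [X in _ + X]eq_bigr do rewrite F1 /cell_coef /=.
under [in RHS]eq_bigr do rewrite F0 /corner_coef /=.
rewrite [X in _ = _ + X]big1 ?addr0; last by move=> p _; rewrite mul0r.
rewrite big_ord_recr [X in _ + X = _]big_ord_recr [RHS]big_ord_recr /= ltnn !mul0r !addr0.
rewrite -big_split /=.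
have := wt_newton_sum (a i) Q g y0 y1; set S1 := \sum_(r < _) _ => WN.
transitivity S1; first by apply: eq_bigr => r _; rewrite -ltnS ltn_ord.
by rewrite WN; congr (_ + _); apply: eq_bigr => r _; rewrite -ltnS ltn_ord.
Qed.

Definition corner_cst (i : 'I_n) (t : T) : R :=
  `|sval (cid (newton_bounded t.2 (a i)))| + `|sval (cid (@wt_bounded R Q (a i)))|.

Lemma corner_coef_le y i t : 0 <= y 0 i <= 1 -> `|corner_coef y i t| <= corner_cst i t.
Proof.
move=> /andP[y0 y1]; rewrite /corner_coef /corner_cst.
case: cid => C /= HC; case: cid => D /= HD.
case: ifP => _; last by rewrite normr0 addr_ge0.
case: ifP => _.
  by apply: le_trans (HC _ y0 y1) _; rewrite (le_trans (ler_norm _))// lerDl.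
by apply: le_trans (HD _) _; rewrite (le_trans (ler_norm _))// lerDr.
Qed.

(** Differentiating [newton p] more than [p] times gives zero, and the boundary order exceeds [Q],
    hence [a i]. So only differences of order at least [a] survive. *)
Lemma corner_coef0 y i t : corner_coef y i t != 0 -> t.1 = ord0 /\ (a i <= t.2)%N.
Proof.
rewrite /corner_coef; have [t1|_] := eqVneq t.1 ord0; last by rewrite eqxx.
move=> h; split=> //; move: h; case: ifP => [tQ|]; last first.
  move=> /negbT; rewrite -ltnNge => Qt _.
  by rewrite (leq_trans (mabs_ge a i))// (leq_trans (ltnW aQ))// ltnW.
by rewrite leqNgt; apply: contra => /newton_deriv0 ->.
Qed.

(** Merges the sums over corners and over orders into one sum of products over coordinates, the form
    required by [sum_prod_swap]; the box is padded to [Q + 1] with zero coefficients. *)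
Lemma taylor_cell l x xi :
  \sum_c taylor u Q (mlist b) a (corner l c) (x, xi) =
  \sum_(q : {ffun 'I_n -> T})
    (\prod_j cell_coef (xi - latt R l) j (q j)) * cell_diff x l q.
Proof.
pose h (c : {ffun 'I_n -> 'I_2}) (r : {ffun 'I_n -> 'I_Q.+2}) :=
  (\prod_j cell_coef (xi - latt R l) j (c j, r j)) * cell_diff x l [ffun j => (c j, r j)].
transitivity (\sum_c \sum_r h c r).
  apply: eq_bigr => c _; rewrite /taylor (sum_box_sub _ (leqnSn Q)) big_mkcond /=.
  rewrite big_map big_enum /=; apply: eq_bigr => r _.
  set p : {ffun 'I_n -> nat} := [ffun j => _].
  have -> : h c r = (\prod_j cell_coef (xi - latt R l) j (c j, r j)) *
      dcoef u (mlist b) p x (corner l c).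
    rewrite /h /cell_diff; congr (_ * dcoef _ _ _ _ _).
      by apply/funext => j; rewrite /p !ffunE.
    by apply/matrixP => i j; rewrite !mxE ffunE.
  rewrite [RHS]mulrC mem_box; case: ifPn => [/forallP pQ|].
    congr (_ * _); apply: eq_bigr => j _; rewrite /cell_coef /=.
    have := pQ j; rewrite /p ffunE => -> /=; rewrite !mxE /=.
    by rewrite intrD opprD addrA.
  rewrite negb_forall => /existsP[j]; rewrite /p ffunE => rj.
  by rewrite (bigD1 j)//= /cell_coef /= (negbTE rj) mul0r mulr0.
rewrite pair_bigA /= (reindex (fun q : {ffun 'I_n -> T} =>
  ([ffun j => (q j).1] : {ffun 'I_n -> 'I_2},
   [ffun j => (q j).2] : {ffun 'I_n -> 'I_Q.+2}))) /=.
  apply: eq_bigr => q _; rewrite /h; congr (_ * _).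
    by apply: eq_bigr => j _; rewrite !ffunE -surjective_pairing.
  by congr cell_diff; apply/ffunP => j; rewrite !ffunE -surjective_pairing.
exists (fun w : {ffun 'I_n -> 'I_2} * {ffun 'I_n -> 'I_Q.+2} =>
  [ffun j => (w.1 j, w.2 j)] : {ffun 'I_n -> T}) => [q|[c r]] _.
  by apply/ffunP => j; rewrite !ffunE -surjective_pairing.
by congr pair; apply/ffunP => j; rewrite !ffunE.
Qed.

(** After [cell_swap] the nonzero terms carry differences at [l] alone, of order at least [a j] in
    each coordinate [j], and these have the required decay. *)
Lemma taylor_cell_le : exists2 C : R, 0 <= C & forall l (x xi : V),
  (forall j, 0 <= xi 0 j - (l 0 j)%:~R <= 1) ->
  `|\sum_c taylor u Q (mlist b) a (corner l c) (x, xi)| <=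
  C * jap l `^ (m - rho * (mabs a)%:R + delta * (mabs b)%:R).
Proof.
set s := _ + _.
pose D q := (\prod_j corner_cst j (q j)) * ccst (fun j => (q j).2 : nat) b.
have D0 q : 0 <= D q.
  rewrite mulr_ge0// ?normr_ge0// prodr_ge0// => j _.
  by rewrite addr_ge0.
exists (\sum_q D q) => [|l x xi xil]; first by apply: sumr_ge0.
have yl j : 0 <= (xi - latt R l) 0 j <= 1 by rewrite !mxE.
rewrite taylor_cell cell_swap// mulr_suml; apply: le_trans (ler_norm_sum _ _ _) _.
apply: ler_sum => q _.
case: (boolP [forall j, corner_coef (xi - latt R l) j (q j) != 0]) =>
  [/forallP cn|]; last first.
  rewrite negb_forall => /existsP[j]; rewrite negbK => /eqP c0.
  by rewrite (bigD1 j)//= c0 !mul0r normr0 mulr_ge0// powR_ge0.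
have q1 j : (q j).1 = ord0 by have [] := corner_coef0 (cn j).
have q2 j : (a j <= (q j).2)%N by have [] := corner_coef0 (cn j).
rewrite normrM normr_prod /D -mulrA; apply: ler_pM => //.
- by apply: prodr_ge0 => *.
- by apply: ler_prod => j _; rewrite normr_ge0 corner_coef_le.
rewrite /cell_diff (_ : \row_j _ = l); last first.
  by apply/matrixP => i j; rewrite ord1 mxE q1 addr0.
apply: le_trans (dcoef_le _ _ _ _) _.
apply: ler_wpM2l; first exact: normr_ge0.
apply: ler_powR; first exact: japanese_ge1.
rewrite /s.
have : (mabs a)%:R <= (mabs (fun j => (q j).2 : nat))%:R :> R.
  by rewrite ler_nat; apply: leq_sum => j _; exact: q2.
move=> /(ler_wpM2l (ltW rho_gt0)); lra.
Qed.

End LowOrder.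

Lemma ext_bound a b : exists C : R, forall x xi : V,
  `|ext u order (mlist b) a (x, xi)| <=
  C * japanese xi `^ (m - rho * (mabs a)%:R + delta * (mabs b)%:R).
Proof.
(* A fixed [Q] above [|a|] and all entries of [b]. Each corner term is split into its truncation at
   [Q], common to the whole cell, and the error controlled by [taylor_order_le]. *)
set s := _ + _; pose Q := (mabs a + mabs b).+1.
have aQ : (mabs a < Q)%N by rewrite ltnS leq_addr.
have bQ j : (b j <= Q)%N.
  by rewrite (leq_trans (mabs_ge b j))// (leq_trans (leq_addl (mabs a) _)).
have [C1 C10 HC1] := taylor_order_le aQ bQ.
have [C2 C20 HC2] := taylor_cell_le b aQ.
have [c c0 Hc] := @japanese_pow_near R n 2 s.
exists (#|{ffun 'I_n -> 'I_2}|%:R * (C1 * c) + C2 * c) => x xi.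
pose l := floorv xi.
rewrite (@ext_local _ _ _ _ _ _ l) /cell => [|j]; last exact: floorv_cell.
rewrite (eq_bigr (fun d =>
    (taylor u (order (corner l d)) (mlist b) a (corner l d) (x, xi) -
    taylor u Q (mlist b) a (corner l d) (x, xi)) +
    taylor u Q (mlist b) a (corner l d) (x, xi))) => [|d _]; last by rewrite subrK.
rewrite big_split /=; apply: le_trans (ler_normD _ _) _.
rewrite mulrDl; apply: lerD.
  apply: le_trans (ler_norm_sum _ _ _) _.
  rewrite -mulrA mulr_natl -sumr_const; apply: ler_sum => d _.
  apply: le_trans (HC1 _ _) _; rewrite -mulrA ler_wpM2l// Hc// => j.
  rewrite !mxE intrD distrC; have := floorv_itv xi j; rewrite mxE => /andP[h1 h2].
  have d0 : 0 <= (d j : nat)%:~R :> R by rewrite ler0z.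
  have d1 : (d j : nat)%:~R <= 1 :> R.
    by rewrite -[leRHS]/(1%:~R) ler_int lez_nat -ltnS ltn_ord.
  by rewrite ler_norml; apply/andP; split; lra.
apply: le_trans (HC2 l x xi _) _ => [j|].
  by have /andP[-> /ltW] := floorv_itv xi j.
rewrite -mulrA ler_wpM2l// Hc// => j.
have := floorv_itv xi j; rewrite !mxE => /andP[h1 h2].
by rewrite distrC ler_norml; apply/andP; split; lra.
Qed.

End Estimate.

(** * Complex-valued symbols *)

Section ComplexSymbols.
Variables (R : realType) (n : nat) (m rho delta : R).
Local Notation V := 'rV[R]_n.
Local Notation Z := 'rV[int]_n.
Local Notation e := (@unitv R n).
Local Notation E := (@unitxxi R n).
Implicit Types (ta : V -> Z -> R[i]) (a b : V * V -> R[i]).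

Lemma real_extension (u : V -> Z -> R) : 0 < rho ->
  (forall k, rsmooth e (u^~ k)) -> tbound m rho delta u ->
  (forall k x j, u (x + (2 * pi) *: e j) k = u x k) ->
  exists A : V * V -> R, [/\ rsmooth E A, ebound m rho delta A,
    forall xi x j, A (x + (2 * pi) *: e j, xi) = A (x, xi) &
    forall x k, A (x, latt R k) = u x k].
Proof.
move=> rho0 su bu pu; have [order [slow unb]] := order_exists rho0 bu.
exists (ext u order [::] (fun=> 0%N)); split.
- exact: ext_smooth.
- by move=> al be; rewrite pd_ext//; apply: (ext_bound rho0 slow unb).
(* Periodicity is inherited because [x] enters only through differences of the values [u x l]. *)
- move=> xi x j; rewrite /ext; apply: eq_fsbigr => k _; apply: eq_bigr => p _ /=.
  congr (_ * _); rewrite /dcoef /=; congr (foldr _ _ _ _).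
  by apply/funext => l; exact: pu.
- by move=> x k; exact: ext_interp.
Qed.

Definition re2 ta := fun x k => complex.Re (ta x k).
Definition im2 ta := fun x k => complex.Im (ta x k).

Lemma Re_toroidal alpha beta ta x k :
  complex.Re (mpow (@fdiff R n) alpha
    (fun l => mpow (fun j => cderive (e j)) beta (ta^~ l) x) k) =
  foldr (@rdiff R n) (fun l => pd e (mlist beta) ((re2 ta)^~ l) x) (mlist alpha) k.
Proof.
rewrite mpowE Re_fdiff; congr (foldr _ _ _ _).
by apply/funext => l; rewrite mpowE Re_pd.
Qed.

Lemma Im_toroidal alpha beta ta x k :
  complex.Im (mpow (@fdiff R n) alpha
    (fun l => mpow (fun j => cderive (e j)) beta (ta^~ l) x) k) =
  foldr (@rdiff R n) (fun l => pd e (mlist beta) ((im2 ta)^~ l) x) (mlist alpha) k.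
Proof.
rewrite mpowE Im_fdiff; congr (foldr _ _ _ _).
by apply/funext => l; rewrite mpowE Im_pd.
Qed.

Lemma dxxiE alpha beta b : dxxi alpha beta b =
  foldr (fun i => cderive (E i)) b (map inr (mlist alpha) ++ map inl (mlist beta)).
Proof. by rewrite /dxxi !mpowE foldr_cat !foldr_map. Qed.

Lemma complex_family_bound (A B : Type) (f : A -> B -> R[i]) (w : B -> R) :
  (forall y, 0 <= w y) ->
  (exists C : R, forall x y, `|f x y| <= (C * w y)%:C) <->
  (exists C : R, forall x y, `|complex.Re (f x y)| <= C * w y) /\
  (exists C : R, forall x y, `|complex.Im (f x y)| <= C * w y).
Proof.
move=> w0; split=> [[C HC]|[[C HC] [D HD]]].
  by split; exists C => x y; have [] := complex_bound (HC x y).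
exists (C + D) => x y; apply: complex_norm_le; rewrite mulrDl.
exact: lerD.
Qed.

Lemma toroidalP ta : (forall k, periodic2pi (ta^~ k)) ->
  toroidal_symbol m rho delta ta <->
  ((forall k, rsmooth e ((re2 ta)^~ k)) /\ tbound m rho delta (re2 ta)) /\
  ((forall k, rsmooth e ((im2 ta)^~ k)) /\ tbound m rho delta (im2 ta)).
Proof.
move=> pta; pose F alpha beta x k := mpow (@fdiff R n) alpha
  (fun l => mpow (fun j => cderive (e j)) beta (ta^~ l) x) k.
have BP alpha beta := @complex_family_bound _ _ (F alpha beta)
  (fun k => japanese (latt R k) `^ (m - rho * (mabs alpha)%:R + delta * (mabs beta)%:R))
  (fun k => powR_ge0 _ _).
split=> [[_ sm bd]|[[rs rb] [js jb]]].
  split; split=> [k|alpha beta]; try by have /csmoothP[] := sm k.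
    have /BP[[C HC] _] := bd alpha beta.
    by exists C => x k; rewrite -Re_toroidal; exact: HC.
  have /BP[_ [C HC]] := bd alpha beta.
  by exists C => x k; rewrite -Im_toroidal; exact: HC.
split=> // [k|alpha beta]; first by apply/csmoothP; split; [exact: rs|exact: js].
apply/BP; split.
  have [C HC] := rb alpha beta; exists C => x k.
  by rewrite /F Re_toroidal; exact: HC.
have [C HC] := jb alpha beta; exists C => x k.
by rewrite /F Im_toroidal; exact: HC.
Qed.

Lemma dxxi_bound b (w : V -> R) alpha beta : (forall y, 0 <= w y) ->
  (exists C : R, forall x xi, `|dxxi alpha beta b (x, xi)| <= (C * w xi)%:C) <->
  (exists C : R, forall x xi, `|pd E (map inr (mlist alpha) ++ map inl (mlist beta))
     (fun z => complex.Re (b z)) (x, xi)| <= C * w xi) /\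
  (exists C : R, forall x xi, `|pd E (map inr (mlist alpha) ++ map inl (mlist beta))
     (fun z => complex.Im (b z)) (x, xi)| <= C * w xi).
Proof.
move=> w0; rewrite dxxiE.
have := @complex_family_bound _ _ (fun x xi => foldr (fun i => cderive (E i)) b
  (map inr (mlist alpha) ++ map inl (mlist beta)) (x, xi)) w w0.
move=> BP; split=> [/BP[[C HC] [D HD]]|[[C HC] [D HD]]].
  split; first by exists C => x xi; rewrite -Re_pd; exact: HC.
  by exists D => x xi; rewrite -Im_pd; exact: HD.
apply/BP; split; [exists C => x xi; rewrite Re_pd; exact: HC|].
by exists D => x xi; rewrite Im_pd; exact: HD.
Qed.

Definition re1 b := fun z => complex.Re (b z).
Definition im1 b := fun z => complex.Im (b z).

Lemma euclideanP b : (forall xi, periodic2pi (fun x => b (x, xi))) ->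
  euclidean_symbol m rho delta b <->
  (rsmooth E (re1 b) /\ ebound m rho delta (re1 b)) /\
  (rsmooth E (im1 b) /\ ebound m rho delta (im1 b)).
Proof.
move=> pb; have BP alpha beta := @dxxi_bound b
  (fun xi => japanese xi `^ (m - rho * (mabs alpha)%:R + delta * (mabs beta)%:R))
  alpha beta (fun xi => powR_ge0 _ _).
split=> [[/csmoothP[rs js] _ bd]|[[rs rb] [js jb]]].
  by split; split=> // alpha beta; have /BP[] := bd alpha beta.
split=> //; first by apply/csmoothP.
by move=> alpha beta; apply/BP; split; [exact: rb|exact: jb].
Qed.

Lemma toroidal_extension ta : 0 < rho -> (forall k, periodic2pi (ta^~ k)) ->
  toroidal_symbol m rho delta ta ->
  exists2 a, euclidean_symbol m rho delta a & forall x k, ta x k = a (x, latt R k).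
Proof.
move=> rho0 pta /(toroidalP pta)[[rs rb] [js jb]].
have [A [sA bA pA iA]] := real_extension rho0 rs rb
  (fun k x j => congr1 (@complex.Re R) (pta k x j)).
have [B [sB bB pB iB]] := real_extension rho0 js jb
  (fun k x j => congr1 (@complex.Im R) (pta k x j)).
exists (fun z => A z +i* B z).
  by apply/euclideanP => // xi x j; rewrite pA pB.
by move=> x k; rewrite iA iB /re2 /im2; case: (ta x k).
Qed.

Lemma euclidean_restrict a : euclidean_symbol m rho delta a ->
  toroidal_symbol m rho delta (fun x k => a (x, latt R k)).
Proof.
move=> ea; have [_ pa _] := ea.
have /(euclideanP pa)[[rs rb] [js jb]] := ea.
apply/toroidalP => //; split; split=> [k|].
- exact: rsmooth_slicex rs.
- exact: ebound_restrict rs rb.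
- exact: rsmooth_slicex js.
- exact: ebound_restrict js jb.
Qed.

Lemma ebound_sub (f g : V * V -> R) : rsmooth E f -> rsmooth E g ->
  ebound m rho delta f -> ebound m rho delta g -> ebound m rho delta (f \- g).
Proof.
move=> sf sg bf bg alpha beta; have [C HC] := bf alpha beta.
have [D HD] := bg alpha beta; exists (C + D) => x xi; rewrite pdB//= mulrDl.
by apply: le_trans (ler_normB _ _) _; exact: lerD.
Qed.

(** The real and imaginary parts of [a - b] obey the same symbol bounds and vanish on the lattice,
    so [ebound_vanish] applies to each. *)
Lemma euclidean_unique a b : 0 < rho ->
  euclidean_symbol m rho delta a -> euclidean_symbol m rho delta b ->
  (forall x k, a (x, latt R k) = b (x, latt R k)) -> smoothing_symbol (a \- b).
Proof.
move=> rho0 ea eb ab; have [_ pa _] := ea; have [_ pb _] := eb.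
have /(euclideanP pa)[[rsa rba] [jsa jba]] := ea.
have /(euclideanP pb)[[rsb rbb] [jsb jbb]] := eb.
have reE : re1 (a \- b) = re1 a \- re1 b.
  by apply/funext => z; rewrite /re1 /= raddfB.
have imE : im1 (a \- b) = im1 a \- im1 b.
  by apply/funext => z; rewrite /im1 /= raddfB.
have rs : rsmooth E (re1 (a \- b)) by rewrite reE; exact: rsmoothB.
have js : rsmooth E (im1 (a \- b)) by rewrite imE; exact: rsmoothB.
split.
- exact/csmoothP.
- by move=> xi x j /=; rewrite pa pb.
- move=> alpha beta N.
  apply/(@dxxi_bound _ (fun xi => japanese xi `^ (- N%:R)) _ _ (fun xi => powR_ge0 _ _)).
  have re0 x k : re1 (a \- b) (x, latt R k) = 0 by rewrite /re1 /= ab subrr.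
  have im0 x k : im1 (a \- b) (x, latt R k) = 0 by rewrite /im1 /= ab subrr.
  have reb : ebound m rho delta (re1 (a \- b)) by rewrite reE; exact: ebound_sub.
  have imb : ebound m rho delta (im1 (a \- b)) by rewrite imE; exact: ebound_sub.
  split; first exact: (ebound_vanish rho0 rs reb re0).
  exact: (ebound_vanish rho0 js imb im0).
Qed.

End ComplexSymbols.

Theorem theorem5p2 (R : realType) (n : nat) (m rho delta : R)
    (rho_gt0 : 0 < rho) (rho_le1 : rho <= 1)
    (delta_ge0 : 0 <= delta) (delta_le1 : delta <= 1) :
  (forall ta : 'rV[R]_n -> 'rV[int]_n -> R[i],
     (forall k, periodic2pi (ta^~ k)) ->
     (toroidal_symbol m rho delta ta <->
      exists2 a : 'rV[R]_n * 'rV[R]_n -> R[i],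
        euclidean_symbol m rho delta a &
        forall x k, ta x k = a (x, latt R k))) /\
  (forall a b : 'rV[R]_n * 'rV[R]_n -> R[i],
     euclidean_symbol m rho delta a -> euclidean_symbol m rho delta b ->
     (forall x k, a (x, latt R k) = b (x, latt R k)) ->
     smoothing_symbol (a \- b)).
Proof.
split=> [ta pta|a b]; last exact: euclidean_unique.
split=> [|[a ea taE]]; first exact: toroidal_extension.
have -> : ta = fun x k => a (x, latt R k).
  by apply/funext => x; apply/funext => k; exact: taE.
exact: euclidean_restrict.
Qed.
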